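(* Let $k\in\mathbb{C}\setminus\{0\}$, $n,e\in\mathbb{C}$ with $e/k\notin\mathbb{Z}$, $V=\widehat V^k_{n,e}$, $V'=\Pi(\widehat V^k_{-n,-e})$, $W$ a $V_k(\mathfrak{gl}(1|1))$-module, $\mathcal Y_1$ an even intertwining operator of type $\binom{V}{V\,W}$, and $\mathcal Y_2$ an even intertwining operator of type $\binom{W}{V'\,V}$. Let $\Delta_{n,e}=\frac ek\left(n+\frac{e}{2k}\right)$. Then for any lowest-conformal-weight vector $v_0\in V'$, the analytic function $$\phi(z)=\langle v_0,\mathcal Y_1(v_{n,e},1)\mathcal Y_2(v_{-n,-e},z)\psi^-v_{n,e}\rangle$$ is a solution to the differential equation \begin{align*} z(1-z)\phi''(z)&+\big[(4\Delta_{n,e}+1)-(8\Delta_{n,e}+1)z\big]\phi'(z)+4\Delta_{n,e}^2z^{-1}\phi(z)\\ &+2\Delta_{n,e}(2\Delta_{n,e}-1)(1-z)^{-1}\phi(z)+\left[\left(\tfrac ek\right)^2-16\Delta_{n,e}^2\right]\phi(z)=0 \end{align*} in the region $U=\{z\in\mathbb{C}: |z|<1\}\setminus(-1,0]$.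
   Context: **Algebra.** $\mathfrak{gl}(1|1)$ has even basis $N,E$ and odd basis $\psi^+,\psi^-$; nonzero brackets $[N,\psi^\pm]=\pm\psi^\pm$, $\{\psi^+,\psi^-\}=E$; invariant form $\kappa(N,E)=\kappa(E,N)=1$, $\kappa(\psi^+,\psi^-)=-\kappa(\psi^-,\psi^+)=1$, zero on other pairs of basis elements. $\widehat{\mathfrak{gl}(1|1)}=\mathfrak{gl}(1|1)\otimes\mathbb{C}[t,t^{-1}]\oplus\mathbb{C}\mathbf{k}$ with $\mathbf k$ central, $[a_r,b_s]=[a,b]_{r+s}+r\kappa(a,b)\delta_{r+s,0}\mathbf{k}$, $a_r=a\otimes t^r$. $V_k(\mathfrak{gl}(1|1))$ is the level-$k$ module induced from the trivial $\mathfrak{gl}(1|1)$-module, a vertex operator superalgebra with conformal vector $\omega=\frac{1}{2k}(N_{-1}E_{-1}+E_{-1}N_{-1}-\psi^+_{-1}\psi^-_{-1}+\psi^-_{-1}\psi^+_{-1})\mathbf 1+\frac{1}{2k^2}E_{-1}^2\mathbf 1$; $L_n$ are the Virasoro modes. Modules are ($\mathbb Z_2$-graded) grading-restricted generalized modules. **Modules.** $V_{n,e}$ is the 2-dimensional Verma $\mathfrak{gl}(1|1)$-module with highest-weight vector $v_{n,e}$: $Nv_{n,e}=(n+\frac12)v_{n,e}$, $Ev_{n,e}=ev_{n,e}$, $\psi^+v_{n,e}=0$. $\widehat V^k_{n,e}$ is the level-$k$ $\widehat{\mathfrak{gl}(1|1)}$-module induced from $V_{n,e}$ (with $a_r$,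 $r>0$, acting by $0$ on $V_{n,e}$ and $a_0$ acting as $a$); for $e/k\notin\mathbb Z$ it is irreducible with lowest conformal weight space $V_{n,e}$ of conformal weight $\Delta_{n,e}$. $\Pi$ denotes parity reversal. In $V=\widehat V^k_{n,e}$ the vector $v_{n,e}$ is even; in $V'=\Pi(\widehat V^k_{-n,-e})$ the highest-weight vector $v_{-n,-e}$ is odd. $V'$ is identified (by an even isomorphism) with the contragredient module of $V$, so there is a pairing $\langle\cdot,\cdot\rangle$ between $V'$ and $V$, satisfying $\langle a_rw',w\rangle=-(-1)^{|a||w'|}\langle w',a_{-r}w\rangle$ for $a\in\mathfrak{gl}(1|1)$, $r\in\mathbb Z$ (extended to the algebraic completion of $V$). The lowest conformal weight of $V'$ is also $\Delta_{n,e}$. **Correlation function.** For lowest-conformal-weight vectors $v_0,v_2\in V'$, $v_1,v_3\in V$, the series $\langle v_0,\mathcal Y_1(v_1,z_1)\mathcal Y_2(v_2,z_2)v_3\rangle$ converges to a multivalued analytic function on $|z_1|>|z_2|>0$. The function $\phi(z)$ is its value at $z_1=1$, $z_2=z$, made single-valued on $U$ using $\log1=0$ and $\log z=\log|z|+i\arg z$ with $-\pi<\arg z<\pi$. *)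

(* Defs.v *)
From HB Require Import structures.
From mathcomp Require Import all_boot all_order all_algebra finmap.
From mathcomp Require Import complex.
From mathcomp Require Import all_classical all_reals all_analysis.
From mathcomp Require Import ring.

Set Implicit Arguments.
Unset Strict Implicit.
Unset Printing Implicit Defensive.

Import Order.TTheory GRing.Theory Num.Theory.
Import numFieldNormedType.Exports.

Local Open Scope classical_set_scope.
Local Open Scope ring_scope.

(** The field of complex numbers is [R[i]] for an arbitrary [R : realType].

    Formal objects are given by their modes: a vertex operator
    [Y(u,x) = \sum_(n : int) u_n x^(-n-1)] is the map [u n w |-> u_n w], and a
    logarithmic intertwining operator
    [Y(w1,x)w2 = \sum_(s : R[i]) \sum_(j : nat) (w1)_(s;j) w2 x^(-s-1) (log x)^j]
    is the map [w1 s j w2 |-> (w1)_(s;j) w2]. *)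

Record superspace (R : realType) := SuperSpace {
  ss_mod :> lmodType R[i];
  parity : bool -> set ss_mod;  (* [false]: even part, [true]: odd part *)
  parity0 : forall p, parity p 0;
  parityP : forall p a u v,
    parity p u -> parity p v -> parity p (a *: u + v);
  parity_split : forall v,
    exists u w, [/\ parity false u, parity true w & v = u + w];
  parity_disj : forall v, parity false v -> parity true v -> v = 0 }.

Definition finite_dim (R : realType) (M : lmodType R[i]) (P : set M) : Prop :=
  exists s : seq M, forall v, P v ->
    exists c : M -> R[i], v = \sum_(x <- s) c x *: x.

Definition gbin (R : realType) (m : int) (i : nat) : R[i] :=
  (\prod_(j < i) (m - j%:Z)%:~R) / (i`!)%:R.

(** In [vact_jacobi], the equation for [(l, m, n)] is the coefficient of
    [x0^(-l-1) x1^(-m-1) x2^(-n-1)] in the super Jacobi identity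
      x0^-1 delta((x1-x2)/x0) Y(u,x1) Y(v,x2)
      - (-1)^(|u||v|) x0^-1 delta((x2-x1)/(-x0)) Y(v,x2) Y(u,x1)
      = x2^-1 delta((x1-x0)/x2) Y(Y(u,x0)v,x2).
    By lower truncation the three sums over [i] are finite, hence agree with
    all their sufficiently long partial sums. *)
Record vertex_action (R : realType) (A M : superspace R) (vac conf : A)
    (YA : A -> int -> A -> A) (YM : A -> int -> M -> M) : Prop := VertexAction {
  vact_linl : forall n w, linear (fun u => YM u n w);
  vact_linr : forall u n, linear (YM u n);
  vact_even : forall p q u n w,
    parity p u -> parity q w -> parity (p (+) q) (YM u n w);
  vact_trunc : forall u w, exists N : int, forall n, N <= n -> YM u n w = 0;
  vact_vacuum : forall n w, YM vac n w = if n == -1 then w else 0;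
  vact_jacobi : forall p q u v (l m n : int) w, parity p u -> parity q v ->
    \forall I \near \oo,
      \sum_(i < I) ((-1) ^+ i * gbin R l i) *:
        (YM u (m + l - i%:Z) (YM v (n + i%:Z) w)
         - ((-1) ^ l * (-1) ^+ (p && q)) *:
             YM v (n + l - i%:Z) (YM u (m + i%:Z) w))
      = \sum_(i < I) gbin R m i *: YM (YA u (l + i%:Z) v) (m + n - i%:Z) w;
  vact_derivative : forall u n w,
    YM (YA conf 0 u) n w = - n%:~R *: YM u (n - 1) w }.

Record vosa (R : realType) := Vosa {
  vo_space :> superspace R;
  vo_Y : vo_space -> int -> vo_space -> vo_space;
  vo_vac : vo_space;
  vo_conf : vo_space;
  vo_charge : R[i];
  vo_action : vertex_action vo_vac vo_conf vo_Y vo_Y;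
  vo_vac_even : parity false vo_vac;
  vo_conf_even : parity false vo_conf;
  vo_creation : forall u, vo_Y u (-1) vo_vac = u;
  vo_creation0 : forall u n, 0 <= n -> vo_Y u n vo_vac = 0;
  (* [L_m] is the mode of index [m + 1] of the conformal vector *)
  vo_virasoro : forall (m n : int) w,
    let L j := vo_Y vo_conf (j + 1) in
    L m (L n w) - L n (L m w) = (m - n)%:~R *: L (m + n) w
      + (if m + n == 0 then (m ^+ 3 - m)%:~R / 12 * vo_charge else 0) *: w;
  vo_graded : forall v, exists s : seq (int * vo_space),
    (forall x, x \in s -> vo_Y vo_conf 1 x.2 = x.1%:~R *: x.2)
    /\ v = \sum_(x <- s) x.2;
  vo_finite : forall j : int,
    finite_dim [set v | vo_Y vo_conf 1 v = j%:~R *: v];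
  vo_lower : exists N : int, forall j : int, j <= N ->
    forall v, vo_Y vo_conf 1 v = j%:~R *: v -> v = 0 }.

Definition generalized_eigenspace (R : realType) (M : lmodType R[i])
    (T : M -> M) (h : R[i]) : set M :=
  [set w | exists N : nat, iter N (fun u => T u - h *: u) w = 0].

(* A module here is a grading-restricted generalized module: [L_0] need not be
   semisimple, and [vm_lower] bounds the weights below in each coset of the
   integers. *)
Record vmodule (R : realType) (A : vosa R) := VModule {
  vm_space :> superspace R;
  vm_Y : A -> int -> vm_space -> vm_space;
  vm_action : vertex_action (vo_vac A) (vo_conf A) (@vo_Y R A) vm_Y;
  vm_graded : forall w, exists s : seq (R[i] * vm_space),
    (forall x, x \in s ->
       generalized_eigenspace (vm_Y (vo_conf A) 1) x.1 x.2)
    /\ w = \sum_(x <- s) x.2;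
  vm_finite : forall h,
    finite_dim (generalized_eigenspace (vm_Y (vo_conf A) 1) h);
  vm_lower : forall h, exists N : nat, forall m : nat, (N <= m)%N ->
    forall w, generalized_eigenspace (vm_Y (vo_conf A) 1) (h - m%:R) w ->
      w = 0 }.

(* [L_0] is the mode of index [1] of the conformal vector *)
Definition weight_space (R : realType) (A : vosa R) (W : vmodule A) (h : R[i])
  : set W := generalized_eigenspace (@vm_Y R A W (vo_conf A) 1) h.

Definition lowest_conformal_weight (R : realType) (A : vosa R) (W : vmodule A)
    (h : R[i]) : Prop :=
  (exists2 w : W, weight_space h w & w != 0) /\
  (forall (h' : R[i]) (w : W), weight_space h' w -> w != 0 ->
     exists m : nat, h' = h + m%:R).

Definition lowest_conformal_weight_vector (R : realType) (A : vosa R)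
    (W : vmodule A) (w : W) : Prop :=
  exists2 h, lowest_conformal_weight W h & weight_space h w.

Section ParityReversal.
Context (R : realType).

Lemma rev_split (M : superspace R) (v : M) :
  exists u w, [/\ parity (~~ false) u, parity (~~ true) w & v = u + w].
Proof.
by have [u [w [pu pw ->]]] := parity_split v; exists w, u; rewrite addrC.
Qed.

Definition rev_superspace (M : superspace R) : superspace R :=
  @SuperSpace R (ss_mod M) (fun p => @parity R M (~~ p))
    (fun p => @parity0 R M (~~ p)) (fun p => @parityP R M (~~ p))
    (@rev_split M) (fun v h0 h1 => @parity_disj R M v h1 h0).

Lemma rev_action (A M : superspace R) vac conf YA YM :
  @vertex_action R A M vac conf YA YM ->
  @vertex_action R A (rev_superspace M) vac conf YA YM.
Proof.
case=> ll lr ev tr vc jc dr; split=> // p q u n w pu qw /=.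
by rewrite -addbN; exact: ev.
Qed.

Definition parity_reversal (A : vosa R) (W : vmodule A) : vmodule A :=
  @VModule R A (rev_superspace W) (@vm_Y R A W) (rev_action (@vm_action R A W))
    (@vm_graded R A W) (@vm_finite R A W) (@vm_lower R A W).

End ParityReversal.

(** [io_jacobi] is the coefficient of
    [x0^(-l-1) x1^(-m-1) x2^(-s-1) (log x2)^j] in the Jacobi identity, whose
    sign is [(-1)^(|u||w1|)] because the operator is even. *)
Record even_intertwining_operator (R : realType) (A : vosa R)
    (W1 W2 W3 : vmodule A) (Y : W1 -> R[i] -> nat -> W2 -> W3) : Prop :=
  EvenIntertwiningOperator {
  io_linl : forall s j w2, linear (fun w1 => Y w1 s j w2);
  io_linr : forall w1 s j, linear (Y w1 s j);
  io_even : forall p q w1 s j w2,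
    parity p w1 -> parity q w2 -> parity (p (+) q) (Y w1 s j w2);
  io_log : forall w1 s w2, exists J : nat, forall j, (J <= j)%N ->
    Y w1 s j w2 = 0;
  io_trunc : forall w1 s w2, exists N : nat, forall (m j : nat), (N <= m)%N ->
    Y w1 (s + m%:R) j w2 = 0;
  io_jacobi : forall p q (u : A) w1 (l m : int) (s : R[i]) (j : nat) w2,
    parity p u -> parity q w1 ->
    \forall I \near \oo,
      \sum_(i < I) ((-1) ^+ i * gbin R l i) *:
        (vm_Y u (m + l - i%:Z) (Y w1 (s + i%:R) j w2)
         - ((-1) ^ l * (-1) ^+ (p && q)) *:
             Y w1 (s + l%:~R - i%:R) j (vm_Y u (m + i%:Z) w2))
      = \sum_(i < I) gbin R m i *:
          Y (vm_Y u (l + i%:Z) w1) (s + m%:~R - i%:R) j w2;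
  io_derivative : forall w1 s j w2,
    Y (vm_Y (vo_conf A) 0 w1) s j w2
    = - s *: Y w1 (s - 1) j w2 + j.+1%:R *: Y w1 (s - 1) j.+1 w2 }.

Inductive gl11 := gN | gE | gPsip | gPsim.

Definition gl11_basis : seq gl11 := [:: gN; gE; gPsip; gPsim].

Definition gl11_odd (a : gl11) : bool :=
  match a with gPsip | gPsim => true | _ => false end.

(* the coefficient of [c] in the superbracket of [a] and [b] *)
Definition gl11_bracket (a b c : gl11) : int :=
  match a, b, c with
  | gN, gPsip, gPsip => 1
  | gPsip, gN, gPsip => -1
  | gN, gPsim, gPsim => -1
  | gPsim, gN, gPsim => 1
  | gPsip, gPsim, gE => 1
  | gPsim, gPsip, gE => 1
  | _, _, _ => 0
  end.

Definition gl11_form (a b : gl11) : int :=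
  match a, b with
  | gN, gE => 1
  | gE, gN => 1
  | gPsip, gPsim => 1
  | gPsim, gPsip => -1
  | _, _ => 0
  end.

Record gl11_action (R : realType) (U : superspace R)
    (rho : gl11 -> U -> U) : Prop := Gl11Action {
  gla_linear : forall a, linear (rho a);
  gla_even : forall a p w, parity p w -> parity (gl11_odd a (+) p) (rho a w);
  gla_bracket : forall a b w,
    rho a (rho b w) - (-1) ^+ (gl11_odd a && gl11_odd b) *: rho b (rho a w)
    = \sum_(c <- gl11_basis) (gl11_bracket a b c)%:~R *: rho c w }.

(* [act a r] is the action of [a_r]; the central element acts as [k], which is
   what level [k] means *)
Record affine_action (R : realType) (k : R[i]) (M : superspace R)
    (act : gl11 -> int -> M -> M) : Prop := AffineAction {
  aff_linear : forall a r, linear (act a r);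
  aff_even : forall a r p w,
    parity p w -> parity (gl11_odd a (+) p) (act a r w);
  aff_bracket : forall a b (r s : int) w,
    act a r (act b s w)
      - (-1) ^+ (gl11_odd a && gl11_odd b) *: act b s (act a r w)
    = \sum_(c <- gl11_basis) (gl11_bracket a b c)%:~R *: act c (r + s) w
      + (if r + s == 0 then (r * gl11_form a b)%:~R * k else 0) *: w }.

(* even maps from a gl(1|1)-module to an affine module which are equivariant
   for the non-negative modes, positive modes acting by zero on the source *)
Record affine_extension (R : realType) (U : superspace R)
    (rho : gl11 -> U -> U) (M : superspace R) (act : gl11 -> int -> M -> M)
    (i : U -> M) : Prop := AffineExtension {
  ext_linear : linear i;
  ext_even : forall p u, parity p u -> parity p (i u);
  ext_zero : forall a u, act a 0 (i u) = i (rho a u);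
  ext_pos : forall a (r : int) u, 0 < r -> act a r (i u) = 0 }.

Record affine_morphism (R : realType) (M P : superspace R)
    (actM : gl11 -> int -> M -> M) (actP : gl11 -> int -> P -> P)
    (f : M -> P) : Prop := AffineMorphism {
  mor_linear : linear f;
  mor_even : forall p w, parity p w -> parity p (f w);
  mor_act : forall a r w, f (actM a r w) = actP a r (f w) }.

(* the level-[k] induced module, by the universal property of induction *)
Record induced_module (R : realType) (k : R[i]) (U : superspace R)
    (rho : gl11 -> U -> U) (M : superspace R) (act : gl11 -> int -> M -> M)
    (i : U -> M) : Prop := InducedModule {
  ind_source : gl11_action rho;
  ind_action : affine_action k act;
  ind_ext : affine_extension rho act i;
  ind_univ : forall (P : superspace R) (actP : gl11 -> int -> P -> P)
      (j : U -> P),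
    affine_action k actP -> affine_extension rho actP j ->
    exists f : M -> P,
      [/\ affine_morphism act actP f, (forall u, f (i u) = j u) &
       forall g : M -> P, affine_morphism act actP g ->
         (forall u, g (i u) = j u) -> forall w, g w = f w] }.

Section FiniteModules.
Context (R : realType).

Definition trivial_parity (p : bool) : set R[i]^o :=
  [set x | p -> x = 0].

Lemma trivial_parity0 p : trivial_parity p 0. Proof. by []. Qed.

Lemma trivial_parityP p a u v :
  trivial_parity p u -> trivial_parity p v -> trivial_parity p (a *: u + v).
Proof. by move=> hu hv /[dup] /hu -> /hv ->; rewrite scaler0 addr0. Qed.

Lemma trivial_split v : exists u w,
  [/\ trivial_parity false u, trivial_parity true w & v = u + w].
Proof. by exists v, 0; rewrite addr0. Qed.

Lemma trivial_disj v : trivial_parity false v -> trivial_parity true v -> v = 0.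
Proof. by move=> _; exact. Qed.

Definition trivial_space : superspace R :=
  SuperSpace trivial_parity0 trivial_parityP trivial_split trivial_disj.

Definition trivial_act (a : gl11) (u : trivial_space) : trivial_space := 0.

Definition verma_parity (p : bool) : set (R[i]^o * R[i]^o)%type :=
  [set x | (if p then x.1 else x.2) = 0].

Lemma verma_parity0 p : verma_parity p 0. Proof. by case: p. Qed.

Lemma verma_parityP p a u v :
  verma_parity p u -> verma_parity p v -> verma_parity p (a *: u + v).
Proof.
by case: p; rewrite /verma_parity /= => -> ->; rewrite scaler0 addr0.
Qed.

Lemma verma_split v : exists u w,
  [/\ verma_parity false u, verma_parity true w & v = u + w].
Proof.
exists (v.1, 0), (0, v.2); split=> //.
by case: v => x y; congr pair; rewrite /= ?addr0 ?add0r.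
Qed.

Lemma verma_disj v : verma_parity false v -> verma_parity true v -> v = 0.
Proof. by case: v => x y; rewrite /verma_parity /= => -> ->. Qed.

(* basis [v = (1, 0)] (highest-weight vector, even) and [psi^- v = (0, 1)] *)
Definition verma_space : superspace R :=
  SuperSpace verma_parity0 verma_parityP verma_split verma_disj.

Definition verma_act (n e : R[i]) (a : gl11) (x : verma_space) : verma_space :=
  match a with
  | gN => ((n + 2^-1) * x.1, (n - 2^-1) * x.2)
  | gE => (e * x.1, e * x.2)
  | gPsip => (e * x.2, 0)
  | gPsim => (0, x.1)
  end.

Definition verma_hwv : verma_space := (1, 0).

Lemma trivial_gl11 : gl11_action trivial_act.
Proof.
split=> [a c u v|a p w _|a b w].
- by rewrite /trivial_act scaler0 addr0.
- exact: parity0.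
- rewrite /trivial_act scaler0 subr0 big1 // => c _; exact: scaler0.
Qed.

Lemma verma_gl11 n e : gl11_action (verma_act n e).
Proof.
split=> [a c [u1 u2] [v1 v2]|a p [x y]|a b [x y]].
- case: a => /=; congr pair => /=; rewrite /GRing.scale /=; ring.
- by case: a; case: p; rewrite /= /verma_parity /= => h; rewrite ?h ?mulr0.
- rewrite /gl11_basis !big_cons big_nil.
  by case: a; case: b; congr pair; rewrite /= /GRing.scale /=; field.
Qed.

End FiniteModules.

(* The generator [vk_gen a] is [a_(-1) 1]. *)
Record Vk_gl11 (R : realType) (k : R[i]) := VkGl11 {
  vk_vosa :> vosa R;
  vk_gen : gl11 -> vk_vosa;
  vk_induced : induced_module k (@trivial_act R)
    (fun a r => vo_Y (vk_gen a) r) (fun c : R[i]^o => c *: vo_vac vk_vosa);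
  vk_conformal : let m a := vo_Y (vk_gen a) (-1) in let vac := vo_vac vk_vosa in
    vo_conf vk_vosa =
      (2 * k)^-1 *: (m gN (m gE vac) + m gE (m gN vac)
                     - m gPsip (m gPsim vac) + m gPsim (m gPsip vac))
      + (2 * k ^+ 2)^-1 *: m gE (m gE vac) }.

Definition affine_mode (R : realType) (k : R[i]) (A : Vk_gl11 k)
    (W : vmodule A) (a : gl11) (r : int) : W -> W := vm_Y (vk_gen A a) r.

(* [V] is the module induced from [V_(n,e)], with highest-weight vector [v] *)
Definition is_Vhat (R : realType) (k : R[i]) (A : Vk_gl11 k) (n e : R[i])
    (V : vmodule A) (v : V) : Prop :=
  exists2 i : verma_space R -> V,
    induced_module k (verma_act n e) (affine_mode (W := V)) i
    & v = i (verma_hwv R).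

(** An identification of [V'] with the contragredient of [V] is encoded by the
    pairing [B]: it is even, identifies each weight space of [V'] with the dual
    of the weight space of [V] of the same weight, and transports the action. *)
Record contragredient_pairing (R : realType) (k : R[i]) (A : Vk_gl11 k)
    (V' V : vmodule A) (B : V' -> V -> R[i]) : Prop := ContragredientPairing {
  cp_linl : forall w (c : R[i]) x y, B (c *: x + y) w = c * B x w + B y w;
  cp_linr : forall w' (c : R[i]) x y, B w' (c *: x + y) = c * B w' x + B w' y;
  cp_even : forall p q w' w, parity p w' -> parity q w -> p != q -> B w' w = 0;
  cp_weight : forall h' h w' w, weight_space h' w' -> weight_space h w ->
    h' != h -> B w' w = 0;
  cp_inj : forall w', (forall w, B w' w = 0) -> w' = 0;
  cp_surj : forall (h : R[i]) (f : V -> R[i]),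
    (forall (c : R[i]) x y, f (c *: x + y) = c * f x + f y) ->
    (forall h' w, h' != h -> weight_space h' w -> f w = 0) ->
    exists2 w', weight_space h w' & forall w, B w' w = f w;
  cp_invariant : forall a (r : int) p w' w, parity p w' ->
    B (affine_mode a r w') w
    = - (-1) ^+ (gl11_odd a && p) * B w' (affine_mode a (- r) w) }.

(* [R[i]] as a [numFieldType], through which it gets its normed topology; the
   derivative [derive1 f] of [f : Cfield R -> Cfield R] is the complex one *)
Definition Cfield (R : realType) : numFieldType := R[i].

Section ComplexAnalysis.
Context (R : realType).

Definition cexp (z : R[i]) : R[i] :=
  (expR (complex.Re z) * cos (complex.Im z)
   +i* (expR (complex.Re z) * sin (complex.Im z)))%C.

Definition carg (z : R[i]) : R :=
  xget 0 [set t : R | - pi < t <= pi /\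
    z = (Normc.normc z * cos t +i* (Normc.normc z * sin t))%C].

Definition clog (z : R[i]) : R[i] := (ln (Normc.normc z) +i* carg z)%C.

(* unconditional (equivalently, absolute) convergence *)
Definition has_csum (I : choiceType) (f : I -> R[i]) (x : R[i]) : Prop :=
  forall eps : R[i], 0 < eps -> exists J0 : {fset I}, forall J : {fset I},
    (J0 `<=` J)%fset -> `|\sum_(i <- J) f i - x| < eps.

Definition csum (I : choiceType) (f : I -> R[i]) : R[i] :=
  xget 0 [set x | has_csum f x].

Definition slit_disk : set R[i] :=
  [set z | `|z| < 1 /\ ~ (complex.Im z = 0 /\ complex.Re z <= 0)].

End ComplexAnalysis.

Section Correlation.
Context (R : realType) (A : vosa R).

(* the term [\sum_j (w1)_(s;j) w2 x^(-s-1) (log x)^j], a finite sum, evaluated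
   with [lz] as the value of [log x] *)
Definition io_term (W1 W2 W3 : vmodule A) (Y : W1 -> R[i] -> nat -> W2 -> W3)
    (w1 : W1) (lz : R[i]) (w2 : W2) (s : R[i]) : W3 :=
  \sum_(j \in [set: nat]) (cexp (- (s + 1) * lz) * lz ^+ j) *: Y w1 s j w2.

(* [<w', Y(w1,z) w2>]: only finitely many [s] contribute, as [w'] pairs to zero
   with all but finitely many weight spaces *)
Definition io_pairing (W1 W2 W3 W3' : vmodule A) (B : W3' -> W3 -> R[i])
    (Y : W1 -> R[i] -> nat -> W2 -> W3)
    (w' : W3') (w1 : W1) (lz : R[i]) (w2 : W2) : R[i] :=
  \sum_(s \in [set: R[i]]) B w' (io_term Y w1 lz w2 s).

(* the terms, indexed by [s], of the series [<v0, Y1(v1,z1) Y2(v2,z2) v3>],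
   with [l1] and [l2] as the values of [log z1] and [log z2] *)
Definition product_term (M0 M1 M2 M3 M4 W : vmodule A) (B : M0 -> M4 -> R[i])
    (Y1 : M1 -> R[i] -> nat -> W -> M4) (Y2 : M2 -> R[i] -> nat -> M3 -> W)
    (v0 : M0) (v1 : M1) (l1 : R[i]) (v2 : M2) (l2 : R[i]) (v3 : M3)
    (s : R[i]) : R[i] :=
  io_pairing B Y1 v0 v1 l1 (io_term Y2 v2 l2 v3 s).

End Correlation.

(* Main.v *)
(** Write [x = e/k] and [D = 2 Delta].  Let [f w] be the value at [z1 = 1] of
    [<psi^- v', Y1(v, z1) w>].  Since [psi^- v'] and [v] are annihilated by all
    positive modes, [f] turns the negative modes of [gl(1|1)] acting on [W] into
    scalars, except for those of [psi^-], on which it agrees with [psi^-_0].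
    Sugawara's formula for [L_(-1)] on [v'] and on [psi^- v'] then shows that
    [phi = f (Y2(v', z) psi^- v)] and [g = f (Y2(psi^- v', z) v)] satisfy, as
    formal logarithmic series,
      [z(1-z) phi' = (x - D + (2D - x) z) phi - x (1-z) g],
      [z(1-z) g' = x phi + (- D - x + (2D + x) z) g],
    which gives the second order equation.  Both exponents of the system at [0]
    are [-D], so the formal solutions are [z^(-D) (P(z) + Q(z) log z)], and the
    two-term recurrence for their coefficients makes [P] and [Q] converge on the
    unit disk.  The general lowest weight vector of [V'] is a combination of
    [v'] and [psi^- v'], and [v'] does not contribute for parity reasons. *)

Require Import Defs.
From HB Require Import structures.
From mathcomp Require Import all_boot all_order all_algebra finmap.
From mathcomp Require Import complex.
From mathcomp Require Import all_classical all_reals all_analysis.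
From mathcomp Require Import ring lra.

Set Implicit Arguments.
Unset Strict Implicit.
Unset Printing Implicit Defensive.

Import Order.TTheory GRing.Theory Num.Theory.
Import numFieldNormedType.Exports.

Local Open Scope classical_set_scope.
Local Open Scope ring_scope.

(** Nothing is known about [W] beyond the module axioms, so the exponents and logarithms of [phi]
    and [g] cannot be read off a decomposition of [W]. The recurrence forces them: the coefficients
    vanish for large [s] by lower truncation, and the equations carry this vanishing from [s] to
    [s - 1] unless [s = D]. The residue of the system at 0 is [- D] plus [x] times the matrix with
    rows (1, -1) and (1, -1). That matrix squares to zero, which is why [- D] is a double exponent
    and why the logarithm occurs at most to the first power. The functional [f] must make sense on
    all of [W] before any convergence is known. It does, because a vector of [W] is a finite sum of
    generalized weight vectors, so that only finitely many modes of [Y1] pair with [psi^- v']. A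
    commutator of [a_r] with [Y1(v, z1)] carries the factor [z1^r], which is 1 here; all negative
    modes of one generator therefore act alike under [f], and the sums over modes in Sugawara's
    formula are geometric in [z]. This is the origin of the singularity at [z = 1]. Convergence of
    the series is a conclusion, drawn from the growth of the recursively determined coefficients. *)

Section LinearMaps.
Context (K : pzRingType) (U V : lmodType K) (f : U -> V).
Hypothesis f_lin : linear f.

Let g : {linear U -> V} := HB.pack f (GRing.isLinear.Build K U V *:%R f f_lin).

Lemma lin0 : f 0 = 0. Proof. exact: (linear0 g). Qed.
Lemma linD : {morph f : x y / x + y}. Proof. exact: (linearD g). Qed.
Lemma linN : {morph f : x / - x}. Proof. exact: (linearN g). Qed.
Lemma linB : {morph f : x y / x - y}. Proof. exact: (linearB g). Qed.
Lemma linZ c : {morph f : x / c *: x}. Proof. by move=> x;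
  exact: (linearZZ g). Qed.
Lemma linS I (r : seq I) (P : pred I) F :
  f (\sum_(i <- r | P i) F i) = \sum_(i <- r | P i) f (F i).
Proof. exact: (linear_sum g). Qed.

End LinearMaps.

Section Eigenspaces.
Context (R : realType) (M : lmodType R[i]) (T : M -> M).
Hypothesis T_lin : linear T.

Local Notation shifted h := (fun u => T u - h *: u).

Lemma shifted_linear h : linear (shifted h).
Proof.
move=> c x y; rewrite T_lin scalerBr scalerDr opprD scalerA mulrC -scalerA.
by rewrite addrACA.
Qed.

Lemma iter_linear N (S : M -> M) : linear S -> linear (iter N S).
Proof. by move=> Sl; elim: N => // N IH c x y; rewrite !iterS IH Sl. Qed.

Lemma geigen0 h : generalized_eigenspace T h 0.
Proof. by exists 0%N. Qed.

Lemma geigen_shift h w :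
  generalized_eigenspace T h (T w - h *: w) -> generalized_eigenspace T h w.
Proof. by case=> N hN; exists N.+1; rewrite iterSr. Qed.

Lemma geigen_eq h w : T w = h *: w -> generalized_eigenspace T h w.
Proof. by move=> e; exists 1%N; rewrite /= e subrr. Qed.

Lemma geigenD h w1 w2 : generalized_eigenspace T h w1 ->
  generalized_eigenspace T h w2 -> generalized_eigenspace T h (w1 + w2).
Proof.
have zero n : iter n (shifted h) 0 = 0.
  exact: (lin0 (iter_linear n (shifted_linear h))).
case=> N1 h1 [N2 h2]; exists (N1 + N2)%N.
rewrite (linD (iter_linear _ (shifted_linear h))) {1}addnC !iterD h1 h2.
by rewrite !zero addr0.
Qed.

Lemma geigenZ h c w :
  generalized_eigenspace T h w -> generalized_eigenspace T h (c *: w).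
Proof.
by case=> N hN; exists N;
  rewrite (linZ (iter_linear _ (shifted_linear h))) hN scaler0.
Qed.

End Eigenspaces.

(** * Consequences of the Jacobi identity *)

Section Binomials.
Context (R : realType).

Lemma gbin00 i : gbin R 0 i = (i == 0)%:R.
Proof.
case: i => [|i]; first by rewrite /gbin big_ord0 divr1.
by rewrite /gbin big_ord_recl /= subr0 mul0r mul0r.
Qed.

Lemma gbinn0 m : gbin R m 0 = 1.
Proof. by rewrite /gbin big_ord0 divr1. Qed.

Lemma gbin1 i : gbin R 1 i.+1 = (i == 0)%:R.
Proof.
case: i => [|i]; first by rewrite /gbin big_ord1 /= subr0 divr1.
by rewrite /gbin 2!big_ord_recl /= /bump /= subrr mul0r mulr0 mul0r.
Qed.

(** The expansion coefficients of [(x1 - x2)^-1] are all 1, so normally ordered products below carry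
    no binomials. *)
Lemma gbinN1 i : (-1) ^+ i * gbin R (-1) i = 1.
Proof.
rewrite /gbin.
have -> : \prod_(j < i) ((-1 - j%:Z)%:~R : R[i]) = (-1) ^+ i * (i`!)%:R.
  elim: i => [|i IH]; first by rewrite big_ord0 mulr1.
  rewrite big_ord_recr /= IH factS natrM exprS.
  have -> : ((-1 - i%:Z)%:~R : R[i]) = - i.+1%:R.
    by rewrite -opprD rmorphN /= -[1 + i%:Z]/((1 + i)%N%:Z) add1n.
  ring.
by rewrite mulrA mulrA -exprD addnn -mul2n exprM sqrrN expr1n expr1n mul1r
  divff //.
Qed.

End Binomials.

Lemma big_ord_first (V : zmodType) (I : nat) (F : nat -> V) :
  (forall i, (0 < i)%N -> F i = 0) -> \sum_(i < I.+1) F i = F 0%N.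
Proof. by move=> h; rewrite big_ord_recl big1 ?addr0 // => i _; apply: h. Qed.

Lemma near_oo_exists (P : nat -> Prop) :
  (\forall I \near \oo, P I) -> exists N, forall I, (N <= I)%N -> P I.
Proof. by case=> N _ h; exists N => I; apply: h. Qed.

Section VertexAction.
Context (R : realType) (A M : superspace R) (vac conf : A).
Context (YA : A -> int -> A -> A) (YM : A -> int -> M -> M).
Hypothesis H : vertex_action vac conf YA YM.

(** Case [l = 0] of the Jacobi identity: on the left only [i = 0] has a nonzero binomial. *)
Lemma vact_commutator p q u v (m n : int) w : parity p u -> parity q v ->
  exists N, forall I, (N <= I)%N ->
  YM u m (YM v n w) - (-1) ^+ (p && q) *: YM v n (YM u m w)
  = \sum_(i < I) gbin R m i *: YM (YA u i%:Z v) (m + n - i%:Z) w.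
Proof.
move=> pu qv.
have [N hN] := near_oo_exists (vact_jacobi H 0 m n w pu qv).
exists N.+1 => -[//|I] NI.
have -> : \sum_(i < I.+1) gbin R m i *: YM (YA u i%:Z v) (m + n - i%:Z) w
  = \sum_(i < I.+1) gbin R m i *: YM (YA u (0 + i%:Z) v) (m + n - i%:Z) w.
  by apply: eq_bigr => i _; rewrite add0r.
rewrite -(hN _ (ltnW NI)).
rewrite (@big_ord_first _ _ (fun i => ((-1) ^+ i * gbin R 0 i) *: (
  YM u (m + 0 - i%:Z) (YM v (n + i%:Z) w) - ((-1) ^ 0 * (-1) ^+ (p && q)) *:
  YM v (n + 0 - i%:Z) (YM u (m + i%:Z) w)))).
  by rewrite gbin00 mulr1 scale1r !addr0 ?subr0 mul1r.
by move=> [//|i] _; rewrite gbin00 mulr0 scale0r.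
Qed.

(** Case [l = -1], [m = 0] of the Jacobi identity: now the right side collapses to [i = 0], and the
    left becomes the normally ordered product. *)
Lemma vact_normal_product p q u v (n : int) w : parity p u -> parity q v ->
  exists N, forall I, (N <= I)%N ->
  YM (YA u (-1) v) n w = \sum_(i < I)
    (YM u (-1 - i%:Z) (YM v (n + i%:Z) w)
     + (-1) ^+ (p && q) *: YM v (n - 1 - i%:Z) (YM u i%:Z w)).
Proof.
move=> pu qv.
have [N hN] := near_oo_exists (vact_jacobi H (-1) 0 n w pu qv).
exists N.+1 => -[//|I] NI.
have := hN _ (ltnW NI).
rewrite (@big_ord_first _ _
  (fun i => gbin R 0 i *: YM (YA u (-1 + i%:Z) v) (0 + n - i%:Z) w)).
  rewrite gbin00 scale1r !addr0 ?subr0 (add0r n) => <-.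
  apply: eq_bigr => i _; rewrite gbinN1 scale1r !add0r exprN1 invrN1 mulN1r.
  by rewrite scaleNr opprK.
by move=> [//|i] _; rewrite gbin00 scale0r.
Qed.

End VertexAction.

Section IntertwiningOperators.
Context (R : realType) (A : vosa R) (W1 W2 W3 : vmodule A).
Context (Y : W1 -> R[i] -> nat -> W2 -> W3).
Hypothesis HY : even_intertwining_operator Y.

Lemma io_commutator p q (u : A) w1 (m : int) s j w2 :
  parity p u -> parity q w1 ->
  exists N, forall I, (N <= I)%N ->
  vm_Y u m (Y w1 s j w2) - (-1) ^+ (p && q) *: Y w1 s j (vm_Y u m w2)
  = \sum_(i < I) gbin R m i *: Y (vm_Y u i%:Z w1) (s + m%:~R - i%:R) j w2.
Proof.
move=> pu qw.
have [N hN] := near_oo_exists (io_jacobi HY 0 m s j w2 pu qw).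
exists N.+1 => -[//|I] NI.
have -> : \sum_(i < I.+1) gbin R m i *: Y (vm_Y u i%:Z w1) (s + m%:~R - i%:R) j
  w2
  = \sum_(i < I.+1) gbin R m i *: Y (vm_Y u (0 + i%:Z) w1) (s + m%:~R - i%:R) j
    w2.
  by apply: eq_bigr => i _; rewrite add0r.
rewrite -(hN _ (ltnW NI)).
rewrite (@big_ord_first _ _ (fun i => ((-1) ^+ i * gbin R 0 i) *: (
  vm_Y u (m + 0 - i%:Z) (Y w1 (s + i%:R) j w2) - ((-1) ^ 0 * (-1) ^+ (p && q))
    *:
  Y w1 (s + 0%:~R - i%:R) j (vm_Y u (m + i%:Z) w2)))).
  by rewrite gbin00 mulr1 scale1r !addr0 ?subr0 mul1r.
by move=> [//|i] _; rewrite gbin00 mulr0 scale0r.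
Qed.

Lemma io_normal_product p q (u : A) w1 s j w2 :
  parity p u -> parity q w1 ->
  exists N, forall I, (N <= I)%N ->
  Y (vm_Y u (-1) w1) s j w2 = \sum_(i < I)
    (vm_Y u (-1 - i%:Z) (Y w1 (s + i%:R) j w2)
     + (-1) ^+ (p && q) *: Y w1 (s - 1 - i%:R) j (vm_Y u i%:Z w2)).
Proof.
move=> pu qw.
have [N hN] := near_oo_exists (io_jacobi HY (-1) 0 s j w2 pu qw).
exists N.+1 => -[//|I] NI.
have := hN _ (ltnW NI).
rewrite (@big_ord_first _ _ (fun i => gbin R 0 i *:
   Y (vm_Y u (-1 + i%:Z) w1) (s + 0%:~R - i%:R) j w2)).
  rewrite gbin00 scale1r !addr0 ?subr0 => <-.
  apply: eq_bigr => i _; rewrite gbinN1 scale1r !add0r exprN1 invrN1 mulN1r.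
  by rewrite scaleNr opprK.
by move=> [//|i] _; rewrite gbin00 scale0r.
Qed.

Lemma io_L0_commutator q w1 s j w2 : parity q w1 ->
  vm_Y (vo_conf A) 1 (Y w1 s j w2) =
    Y w1 s j (vm_Y (vo_conf A) 1 w2) - (s + 1) *: Y w1 s j w2
    + j.+1%:R *: Y w1 s j.+1 w2 + Y (vm_Y (vo_conf A) 1 w1) s j w2.
Proof.
move=> qw; have [N hN] := io_commutator 1 s j w2 (vo_conf_even A) qw.
have := hN N.+2 (leq_trans (leqnSn _) (leqnSn _)).
rewrite /= expr0 scale1r 2!big_ord_recl big1 ?addr0; last first.
  by move=> i _; rewrite gbin1 scale0r.
rewrite gbinn0 gbin1 !scale1r (io_derivative HY) /= subr0 addrK => /eqP.
rewrite subr_eq => /eqP ->.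
by rewrite addrC scaleNr !addrA.
Qed.

(** Applying [L_0] minus the expected weight to [Y w1 s j w2] produces one term with [w2] replaced
    by [(L_0 - h2) w2] and one with [j] raised by 1. The proof is an induction on the nilpotency
    order at [w2] and, inside it, a descending induction on [j] that starts where the logarithms
    stop. *)
Lemma io_weight q h1 h2 w1 s j w2 : parity q w1 ->
  vm_Y (vo_conf A) 1 w1 = h1 *: w1 -> weight_space h2 w2 ->
  weight_space (h1 + h2 - s - 1) (Y w1 s j w2).
Proof.
move=> qw e1 [n].
have Tl : linear (@vm_Y _ _ W3 (vo_conf A) 1) by apply: (vact_linr (vm_action
  _)).
have Yl w t i := io_linr HY w t i.
elim: n w2 j => [|n IH] w2 j.
  by move=> /= ->; rewrite (lin0 (Yl _ _ _)); apply: geigen0.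
rewrite iterSr => /IH {}IH.
have [J hJ] := io_log HY w1 s w2.
have [d] := ubnP (J - j)%N; elim: d j => // d IHd j hd.
have [Jj|jJ] := leqP J j; first by rewrite hJ //; apply: geigen0.
apply: geigen_shift; rewrite (io_L0_commutator _ _ _ qw) e1.
rewrite (linZ (io_linl HY s j w2)).
have -> : Y w1 s j (vm_Y (vo_conf A) 1 w2) - (s + 1) *: Y w1 s j w2 +
  j.+1%:R *: Y w1 s j.+1 w2 + h1 *: Y w1 s j w2 -
  (h1 + h2 - s - 1) *: Y w1 s j w2 =
  Y w1 s j (vm_Y (vo_conf A) 1 w2 - h2 *: w2) + j.+1%:R *: Y w1 s j.+1 w2.
  rewrite (linB (Yl _ _ _)) (linZ (Yl _ _ _)).
  have -> : h1 + h2 - s - 1 = h1 + (h2 - (s + 1)) by ring.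
  rewrite scalerDl scalerBl opprD addrA addrK opprB.
  by rewrite [X in X + (_ - _)]addrAC subrKA addrAC.
apply: (geigenD Tl); first exact: IH.
apply: (geigenZ Tl); apply: IHd; rewrite -ltnS; apply: leq_trans hd.
by rewrite ltnS subnS prednK // subn_gt0.
Qed.

End IntertwiningOperators.

(** * The Sugawara vector *)

Section Sugawara.
Context (R : realType) (k : R[i]) (A : Vk_gl11 k).

Local Notation gen := (vk_gen A).
Local Notation vac := (vo_vac A).
Local Notation sgn a b := ((-1 : R[i]) ^+ (gl11_odd a && gl11_odd b)).

Let VA := ind_action (vk_induced A).
Let VL a r := aff_linear VA a r.

Lemma vk_gen_parity a : parity (gl11_odd a) (gen a).
Proof.
have := aff_even VA a (-1) (vo_vac_even A).
by rewrite addbF vo_creation.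
Qed.

(** Since [gen c] is [c_(-1) 1] and [a_r] kills the vacuum for [r >= 0], this is the affine bracket
    of [a_r] with [c_(-1)], applied to the vacuum. *)
Lemma vk_gen_mode a c (r : int) : 0 <= r ->
  vo_Y (gen a) r (gen c) =
    if r == 0 then \sum_(d <- gl11_basis) (gl11_bracket a c d)%:~R *: gen d
    else if r == 1 then ((gl11_form a c)%:~R * k) *: vac else 0.
Proof.
move=> r0; have := aff_bracket VA a c r (-1) vac.
rewrite vo_creation (vo_creation0 (gen a) r0) (lin0 (VL c (-1))) scaler0 subr0
  => ->.
rewrite subr_eq0; case: (eqVneq r 0) => [->|rn0].
  rewrite scale0r addr0 add0r.
  by apply: eq_bigr => d _; rewrite vo_creation.
rewrite big1; last first.
  move=> d _; rewrite vo_creation0 ?scaler0 //.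
  by rewrite subr_ge0 -gtz0_ge1 lt_def rn0.
by rewrite add0r; case: eqVneq => [->|_]; rewrite ?mul1r ?scale0r.
Qed.

Section Action.
Context (M : superspace R) (YM : A -> int -> M -> M).
Hypothesis H : vertex_action vac (vo_conf A) (@vo_Y R A) YM.

Let ML u n : linear (YM u n) := vact_linr H u n.

Definition quadratic_mode a b n w := YM (vo_Y (gen a) (-1) (gen b)) n w.

Lemma vk_conf_mode n w :
  YM (vo_conf A) n w =
    (2 * k)^-1 *: (quadratic_mode gN gE n w + quadratic_mode gE gN n w
       - quadratic_mode gPsip gPsim n w + quadratic_mode gPsim gPsip n w)
    + (2 * k ^+ 2)^-1 *: quadratic_mode gE gE n w.
Proof.
have Yl := vact_linl H n w.
rewrite (vk_conformal A) !vo_creation (linD Yl) !(linZ Yl) !(linD Yl) (linN Yl).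
by [].
Qed.

Lemma quadratic_mode1 a b w :
  (forall c (r : int), 1 < r -> YM (gen c) r w = 0) ->
  quadratic_mode a b 1 w = YM (gen a) (-1) (YM (gen b) 1 w)
    + sgn a b *: (YM (gen b) 0 (YM (gen a) 0 w) + YM (gen b) (-1) (YM (gen a) 1
      w)).
Proof.
move=> top.
have [N hN] := vact_normal_product H 1 w (vk_gen_parity a) (vk_gen_parity b).
rewrite /quadratic_mode (hN N.+2 (leq_trans (leqnSn _) (leqnSn _))).
rewrite !big_ord_recl big1 ?addr0; last first.
  by move=> i _; rewrite !top ?(lin0 (ML _ _)) ?scaler0 ?addr0.
rewrite /= (top b (1 + 1%N%:Z)) // (lin0 (ML _ _)) add0r scalerDr !addrA.
by [].
Qed.

Lemma quadratic_mode0 a b w :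
  (forall c (r : int), 0 < r -> YM (gen c) r w = 0) ->
  quadratic_mode a b 0 w = YM (gen a) (-1) (YM (gen b) 0 w)
    + sgn a b *: YM (gen b) (-1) (YM (gen a) 0 w).
Proof.
move=> top.
have [N hN] := vact_normal_product H 0 w (vk_gen_parity a) (vk_gen_parity b).
rewrite /quadratic_mode (hN N.+1 (leqnSn _)).
rewrite !big_ord_recl big1 ?addr0 //.
by move=> i _; rewrite !top ?(lin0 (ML _ _)) ?scaler0 ?addr0.
Qed.

End Action.

Hypothesis k0 : k != 0.

(** The only delicate generator is [gN]: the odd terms of the conformal vector contribute [- E / k]
    to [L_0 N], and the [E^2] term is there to cancel it. *)
Lemma vk_gen_weight c : vo_Y (vo_conf A) 1 (gen c) = gen c.
Proof.
have top d (r : int) : 1 < r -> vo_Y (gen d) r (gen c) = 0.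
  move=> r1; rewrite vk_gen_mode ?(ltW (lt_trans _ r1)) //.
  by rewrite gt_eqF ?(lt_trans _ r1) // gt_eqF.
have mode0 a d : vo_Y (gen a) 0 (gen d) =
    \sum_(x <- gl11_basis) (gl11_bracket a d x)%:~R *: gen x.
  by rewrite vk_gen_mode.
have mode1 a d : vo_Y (gen a) 1 (gen d) = ((gl11_form a d)%:~R * k) *: vac.
  by rewrite vk_gen_mode.
rewrite (vk_conf_mode (vo_action A)) !(quadratic_mode1 (vo_action A) _ _ top).
rewrite !mode1 !mode0 !(linZ (VL _ _)) !vo_creation /gl11_basis.
have kE : (2 * k)^-1 = k^-1 / 2 by rewrite invfM mulrC.
have zE d : vo_Y (gen gE) 0 (gen d) = 0.
  rewrite mode0 /gl11_basis !big_cons big_nil.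
  by case: d => /=; rewrite !scale0r !addr0.
have zE' d : vo_Y (gen d) 0 (gen gE) = 0.
  rewrite mode0 /gl11_basis !big_cons big_nil.
  by case: d => /=; rewrite !scale0r !addr0.
have zpm : vo_Y (gen gPsip) 0 (gen gPsim) = gen gE.
  rewrite mode0 /gl11_basis !big_cons big_nil /=.
  by rewrite !scale0r !addr0 add0r scale1r.
have zmp : vo_Y (gen gPsim) 0 (gen gPsip) = gen gE.
  rewrite mode0 /gl11_basis !big_cons big_nil /=.
  by rewrite !scale0r !addr0 add0r scale1r.
case: c {top}; rewrite !big_cons !big_nil /=; rewrite ?expr0 ?expr1 ?mul0r
  ?scale0r ?scale1r ?add0r ?addr0 ?scaler0 ?addr0 ?(lin0 (VL _ _)) ?scaler0
  ?addr0 ?add0r ?scaler0 ?addr0 ?subr0 ?oppr0 ?(linZ (VL _ _)) ?zpm ?zmp ?zE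
  ?zE' ?scaler0 ?add0r.
- rewrite scalerA -[X in _ *: X + _]addrA -scaleNr -!scalerDl scalerDr.
  rewrite !scalerA -addrA -scalerDl -[RHS]scale1r -[RHS]addr0.
  congr (_ + _); first by congr (_ *: _); rewrite /GRing.scale /=; field.
  by rewrite [X in X *: _](_ : _ = 0) ?scale0r // /GRing.scale /=; field.
- by rewrite -scalerDl scalerA -[RHS]scale1r; congr (_ *: _); field.
- by rewrite -scaleNr scalerA -scalerDl scalerA -[RHS]scale1r; congr (_ *: _);
  field.
- by rewrite scalerA -scaleNr -scalerDl scalerA -[RHS]scale1r; congr (_ *: _);
  field.
Qed.

Lemma L0_gen_commutator (M : superspace R) (YM : A -> int -> M -> M)
    (H : vertex_action vac (vo_conf A) (@vo_Y R A) YM) a (r : int) w :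
  YM (vo_conf A) 1 (YM (gen a) r w) =
    YM (gen a) r (YM (vo_conf A) 1 w) - r%:~R *: YM (gen a) r w.
Proof.
have [N hN] := vact_commutator H 1 r w (vo_conf_even A) (vk_gen_parity a).
have := hN N.+2 (leq_trans (leqnSn _) (leqnSn _)).
rewrite /= expr0 scale1r 2!big_ord_recl big1 ?addr0; last first.
  by move=> i _; rewrite gbin1 scale0r.
rewrite gbinn0 gbin1 !scale1r (vact_derivative H) /= vk_gen_weight.
move=> /eqP; rewrite subr_eq => /eqP ->; rewrite addrC.
rewrite -[bump 0 0]/1%N; have -> : 1 + r - 1 = r by rewrite addrAC subrr add0r.
by rewrite intrD scaleNr scalerDl scale1r opprD addrAC addNr add0r.
Qed.

(** Mode 0 of the conformal vector is [L_(-1)]. Both orderings of each pair of generators give the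
    same two terms, up to the sign already present, so they double up and [(2 * k)^-1] turns into
    [k^-1]. *)
Lemma conf_mode0_top (M : superspace R) (YM : A -> int -> M -> M)
    (H : vertex_action vac (vo_conf A) (@vo_Y R A) YM) w :
  (forall c (r : int), 0 < r -> YM (gen c) r w = 0) ->
  YM (vo_conf A) 0 w =
    k^-1 *: (YM (gen gN) (-1) (YM (gen gE) 0 w)
             + YM (gen gE) (-1) (YM (gen gN) 0 w)
             - YM (gen gPsip) (-1) (YM (gen gPsim) 0 w)
             + YM (gen gPsim) (-1) (YM (gen gPsip) 0 w))
    + (k ^+ 2)^-1 *: YM (gen gE) (-1) (YM (gen gE) 0 w).
Proof.
move=> top; rewrite (vk_conf_mode H) !(quadratic_mode0 H _ _ top) /=.
rewrite !expr0 !expr1 !scale1r !scaleN1r.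
set a := YM (gen gN) _ _; set b := YM (gen gE) (-1) (YM (gen gN) _ _).
set c := YM (gen gPsip) _ _; set d := YM (gen gPsim) _ _;
  set x := YM (gen gE) (-1) (YM (gen gE) _ _).
congr (_ + _); last first.
  by rewrite -[x + x]mulr2n -(scaler_nat 2 x) scalerA; congr (_ *: _); field.
have -> : a + b + (b + a) - (c - d) + (d - c) = 2%:R *: (a + b - c + d).
  rewrite -[a + b - c + d]addrA [- c + d]addrC [b + a]addrC opprB.
  by rewrite (scaler_nat 2) mulr2n -[LHS]addrA addrACA.
by rewrite scalerA; congr (_ *: _); field.
Qed.

Lemma conf_mode1_top (M : superspace R) (YM : A -> int -> M -> M)
    (H : vertex_action vac (vo_conf A) (@vo_Y R A) YM) w :
  (forall c (r : int), 0 < r -> YM (gen c) r w = 0) ->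
  YM (vo_conf A) 1 w =
    (2 * k)^-1 *: (YM (gen gE) 0 (YM (gen gN) 0 w)
             + YM (gen gN) 0 (YM (gen gE) 0 w)
             + YM (gen gPsim) 0 (YM (gen gPsip) 0 w)
             - YM (gen gPsip) 0 (YM (gen gPsim) 0 w))
    + (2 * k ^+ 2)^-1 *: YM (gen gE) 0 (YM (gen gE) 0 w).
Proof.
have ML u n : linear (YM u n) := vact_linr H u n.
move=> top.
have top1 c (r : int) : 1 < r -> YM (gen c) r w = 0.
  by move=> r1; apply: top; apply: lt_trans r1.
rewrite (vk_conf_mode H) !(quadratic_mode1 H _ _ top1) /= !(top _ 1) //.
by rewrite !(lin0 (ML _ _)) !expr0 !expr1 !scale1r !scaleN1r !addr0 !add0r
  opprK.
Qed.

End Sugawara.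

(** * Induced modules *)

Section Submodule.
Context (R : realType) (M : superspace R) (S : set M).
Hypothesis S0 : S 0.
Hypothesis SP : forall c x y, S x -> S y -> S (c *: x + y).
Hypothesis S_graded : forall x, S x ->
  exists u w, [/\ parity false u /\ S u, parity true w /\ S w & x = u + w].

Definition sub_pred : {pred M} := fun x => `[< S x >].

Lemma sub_closed : submod_closed sub_pred.
Proof.
split; first exact/asboolP.
by move=> c x y /asboolP Sx /asboolP Sy; apply/asboolP; apply: SP.
Qed.

HB.instance Definition _ :=
  GRing.isSubmodClosed.Build R[i] M sub_pred sub_closed.

(** The universal property of induction quantifies over superspaces, so a graded subspace given as a
    set has to become a type before it can serve as a target. *)
Record sub_type := SubType { sub_val :> M; sub_valP : sub_val \in sub_pred }.

HB.instance Definition _ := [isSub for sub_val].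
HB.instance Definition _ := [Choice of sub_type by <:].
HB.instance Definition _ := [SubChoice_isSubLmodule of sub_type by <:].

Definition sub_parity p : set sub_type := [set x | parity p (val x)].

Lemma sub_parity0 p : sub_parity p 0.
Proof. exact: parity0. Qed.

Lemma sub_parityP p a u v :
  sub_parity p u -> sub_parity p v -> sub_parity p (a *: u + v).
Proof.
exact: parityP.
Qed.

Lemma sub_split v : exists u w,
  [/\ sub_parity false u, sub_parity true w & v = u + w].
Proof.
have /asboolP/S_graded[u [w [[pu Su] [pw Sw] e]]] := sub_valP v.
exists (@SubType u (asboolT Su)), (@SubType w (asboolT Sw)).
by split=> //; apply: val_inj.
Qed.

Lemma sub_disj v : sub_parity false v -> sub_parity true v -> v = 0.
Proof. by move=> p0 p1; apply: val_inj; apply: (@parity_disj R M). Qed.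

Definition sub_superspace : superspace R :=
  SuperSpace sub_parity0 sub_parityP sub_split sub_disj.

End Submodule.

Section InducedModule.
Context (R : realType) (k : R[i]) (U : superspace R) (rho : gl11 -> U -> U).
Context (M : superspace R) (act : gl11 -> int -> M -> M) (i : U -> M).
Hypothesis HI : induced_module k rho act i.

Let actl a r : linear (act a r) := aff_linear (ind_action HI) a r.

(* The universal property yields a morphism from [M] to the submodule on [S]
   whose composite with the inclusion must be the identity. *)
Lemma induced_graded_ind (S : set M) : S 0 ->
  (forall c x y, S x -> S y -> S (c *: x + y)) ->
  (forall x, S x ->
    exists u w, [/\ parity false u /\ S u, parity true w /\ S w & x = u + w]) ->
  (forall u, S (i u)) -> (forall a r x, S x -> S (act a r x)) ->
  forall w, S w.
Proof.
move=> S0 SP Sgr Si Sact.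
pose P := sub_superspace S0 SP Sgr.
have val_lin : linear (val : P -> M) by [].
have PE (x : P) : S (val x) by have /asboolP := sub_valP x.
pose actP a r (x : P) : P :=
  @SubType _ _ _ (act a r (val x)) (asboolT (Sact a r _ (PE x))).
pose j u : P := @SubType _ _ _ (i u) (asboolT (Si u)).
have valS c (x y : P) : val (c *: x + y) = c *: val x + val y by [].
have affP : affine_action k actP.
  split=> [a r c x y|a r p x px|a b r s x].
  - by apply: val_inj; rewrite valS /= actl.
  - exact: (aff_even (ind_action HI)).
  - apply: val_inj; rewrite /= (aff_bracket (ind_action HI)); congr (_ + _).
    have /= := linS val_lin gl11_basis xpredT
      (fun c => (gl11_bracket a b c)%:~R *: actP c (r + s) x).
    by move->.
have extP : affine_extension rho actP j.
  split=> [c x y|p u pu|a u|a r u r0].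
  - by apply: val_inj; rewrite valS /= (ext_linear (ind_ext HI)).
  - exact: (ext_even (ind_ext HI)).
  - by apply: val_inj; rewrite /= (ext_zero (ind_ext HI)).
  - by apply: val_inj; rewrite /= (ext_pos (ind_ext HI)).
have [f [fm fi _]] := ind_univ HI affP extP.
have [g [_ _ g_uniq]] := ind_univ HI (ind_action HI) (ind_ext HI).
move=> w; suff -> : w = val (f w) by exact: PE.
transitivity (g w); first by apply: (g_uniq id).
symmetry; apply: (g_uniq (fun x => val (f x))).
  split=> [c x y|p x px|a r x].
  - by rewrite (mor_linear fm).
  - exact: (mor_even fm).
  - by rewrite (mor_act fm).
by move=> u; rewrite fi.
Qed.

(** The graded version applies to [S'], the sums of an even and an odd element of [S]. It is graded
    by construction, stable because modes are homogeneous, and contained in [S]. *)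
Lemma induced_ind (S : set M) : S 0 ->
  (forall c x y, S x -> S y -> S (c *: x + y)) ->
  (forall u, S (i u)) -> (forall a r x, S x -> S (act a r x)) ->
  forall w, S w.
Proof.
move=> S0 SP Si Sact w.
have SD x y : S x -> S y -> S (x + y).
  by move=> Sx Sy; rewrite -[x]scale1r; apply: SP.
pose S' := [set x : M | exists u w,
  [/\ parity false u /\ S u, parity true w /\ S w & x = u + w]].
suff : S' w by case=> x [y [[_ Sx] [_ Sy] ->]]; apply: SD.
apply: (induced_graded_ind (S := S')).
- by exists 0, 0; rewrite addr0; split=> //; split=> //; apply: parity0.
- move=> c _ _ [u1 [w1 [[pu1 Su1] [pw1 Sw1] ->]]] [u2 [w2 [[pu2 Su2] [pw2 Sw2]
  ->]]].
  exists (c *: u1 + u2), (c *: w1 + w2); split.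
  + by split; [exact: parityP|exact: SP].
  + by split; [exact: parityP|exact: SP].
  + by rewrite scalerDr addrACA.
- move=> x [u [v [[pu Su] [pv Sv] ->]]]; exists u, v; split=> //; split=> //.
  + by exists u, 0; rewrite addr0; split=> //; split=> //; apply: parity0.
  + by exists 0, v; rewrite add0r; split=> //; split=> //; apply: parity0.
- move=> u; have [x [y [px py ->]]] := parity_split u.
  have il := ext_linear (ind_ext HI); have ie := ext_even (ind_ext HI).
  by exists (i x), (i y); rewrite (linD il); split=> //; split=> //; apply: ie.
- move=> a r _ [u [v [[pu Su] [pv Sv] ->]]].
  have := aff_even (ind_action HI) a r pu;
    have := aff_even (ind_action HI) a r pv.
  rewrite (linD (actl a r)); case: (gl11_odd a) => /= pv' pu'.
    by exists (act a r v), (act a r u); rewrite addrC; split=> //; split=> //;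
      apply: Sact.
  by exists (act a r u), (act a r v); split=> //; split=> //; apply: Sact.
Qed.

(** The span of the products of negative modes of total degree [- m] applied to the top space.
    Generating it inductively allows degree arguments without a PBW basis. *)
Inductive graded_piece : int -> M -> Prop :=
| GradedZero m : graded_piece m 0
| GradedTop u : graded_piece 0 (i u)
| GradedComb m c x y :
    graded_piece m x -> graded_piece m y -> graded_piece m (c *: x + y)
| GradedMode m a (r : int) x :
    r < 0 -> graded_piece m x -> graded_piece (m - r) (act a r x).

Lemma graded_pieceD m x y :
  graded_piece m x -> graded_piece m y -> graded_piece m (x + y).
Proof. by move=> gx gy; rewrite -[x]scale1r; apply: GradedComb. Qed.

Lemma graded_pieceZ m c x : graded_piece m x -> graded_piece m (c *: x).
Proof. by move=> gx; rewrite -[_ *: _]addr0; apply: GradedComb => //;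
  apply: GradedZero. Qed.

Lemma graded_piece_sum m (I : Type) (s : seq I) (F : I -> M) :
  (forall j, graded_piece m (F j)) -> graded_piece m (\sum_(j <- s) F j).
Proof.
move=> h; elim: s => [|x s IH]; rewrite ?big_nil ?big_cons;
  first exact: GradedZero.
exact: graded_pieceD.
Qed.

(** An arbitrary mode is commuted to the right past the negative modes until it meets the top space.
    The bracket terms and the central term have the correct degree and are covered by the
    induction. *)
Lemma graded_piece_act m w : graded_piece m w ->
  forall a s, graded_piece (m - s) (act a s w).
Proof.
elim=> {m w} [m|u|m c x y _ IHx _ IHy|m b r x r0 gx IH] a s.
- by rewrite (lin0 (actl a s)); apply: GradedZero.
- have [s0|s0|->] := ltgtP s 0.
  + by apply: GradedMode => //; apply: GradedTop.
  + by rewrite (ext_pos (ind_ext HI)) //; apply: GradedZero.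
  + by rewrite (ext_zero (ind_ext HI)) subr0; apply: GradedTop.
- by rewrite actl; apply: GradedComb.
- have /eqP := aff_bracket (ind_action HI) a b s r x.
  rewrite subr_eq => /eqP ->; apply: graded_pieceD; first apply: graded_pieceD.
  + apply: graded_piece_sum => c; apply: graded_pieceZ.
    have -> : m - r - s = m - (s + r) by rewrite opprD addrA addrAC.
    exact: IH.
  + case: eqVneq => [e|_]; last by rewrite scale0r; apply: GradedZero.
    by apply: graded_pieceZ;
      rewrite -addrA -opprD addrC addrC [r + s]addrC e subr0.
  + apply: graded_pieceZ; have -> : m - r - s = m - s - r by rewrite addrAC.
    exact: GradedMode.
Qed.

Lemma graded_piece_neg m w : graded_piece m w -> m < 0 -> w = 0.
Proof.
elim=> {m w} [//|u|m c x y _ IHx _ IHy m0|m a r x r0 _ IH mr].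
- by rewrite ltxx.
- by rewrite IHx // IHy // scaler0 addr0.
- rewrite IH ?(lin0 (actl _ _)) //; apply: lt_trans mr.
  by rewrite ltrBrDr gtrDl.
Qed.

(** A negative mode landing in degree 0 started from a piece of negative degree, which is zero. *)
Lemma graded_piece0 m w : graded_piece m w -> m = 0 -> exists u, w = i u.
Proof.
have il := ext_linear (ind_ext HI).
elim=> {m w} [m _|u|m c x y _ IHx _ IHy m0|m a r x r0 gx IH mr].
- by exists 0; rewrite (lin0 il).
- by exists u.
- have [u ->] := IHx m0; have [v ->] := IHy m0.
  by exists (c *: u + v); rewrite il.
- exists 0; rewrite (lin0 il) (graded_piece_neg gx) ?(lin0 (actl _ _)) //.
  by move/eqP: mr; rewrite subr_eq0 => /eqP ->.
Qed.

Lemma graded_decomposition w : exists s : seq (int * M),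
  (forall x, x \in s -> graded_piece x.1 x.2) /\ w = \sum_(x <- s) x.2.
Proof.
move: w; apply: induced_ind.
- by exists [::]; rewrite big_nil.
- move=> c _ _ [s [hs ->]] [t [ht ->]].
  exists ([seq (x.1, c *: x.2) | x <- s] ++ t); split; last first.
    by rewrite big_cat big_map scaler_sumr.
  move=> x; rewrite mem_cat => /orP[/mapP[y ys ->]|/ht //].
  by apply: graded_pieceZ; exact: (hs y).
- move=> u; exists [:: (0, i u)]; rewrite big_seq1; split=> // x.
  by rewrite inE => /eqP ->; apply: GradedTop.
- move=> a r _ [s [hs ->]]; exists [seq (x.1 - r, act a r x.2) | x <- s].
  rewrite big_map (linS (actl a r)); split=> // x /mapP[y ys ->].
  by apply: graded_piece_act; exact: (hs y).
Qed.

End InducedModule.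

(** * Lowest weight vectors of induced modules *)

Section EigenvectorSums.
Context (R : realType) (M : lmodType R[i]) (T : M -> M).
Hypothesis T_lin : linear T.

Lemma geigen_unique (a h : R[i]) w :
  T w = a *: w -> generalized_eigenspace T h w -> a != h -> w = 0.
Proof.
move=> Tw [N hN] ah.
have : iter N (fun u => T u - h *: u) w = (a - h) ^+ N *: w.
  elim: N {hN} => [|N IH]; first by rewrite expr0 scale1r.
  rewrite iterS IH (linZ T_lin) Tw.
  by rewrite !scalerA exprSr mulrBr scalerBl; congr (_ - _ *: _); rewrite mulrC.
rewrite hN => /esym/eqP; rewrite scaler_eq0 expf_eq0 subr_eq0 (negPf ah) andbF.
by move/eqP.
Qed.

(** Induction on the length. Subtracting the first eigenvalue from [T] kills the first term and
    rescales the others, so by induction the whole sum is an eigenvector for that eigenvalue; as it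
    also lies in a generalized eigenspace for [h], it is zero. *)
Lemma geigen_sum_neq (h : R[i]) (s : seq (R[i] * M)) :
  (forall x, x \in s -> T x.2 = x.1 *: x.2 /\ x.1 != h) ->
  generalized_eigenspace T h (\sum_(x <- s) x.2) -> \sum_(x <- s) x.2 = 0.
Proof.
elim: {s}(size s) {-2}s (erefl (size s)) => [|d IH] [|x s] //= sz hs.
  by rewrite big_nil.
case: sz => sz; have [Tx xh] := hs x (mem_head _ _).
move=> gw; apply: (@geigen_unique x.1 h _ _ gw xh); apply/eqP;
  rewrite -subr_eq0.
set w := \sum_(x <- _) _ in gw *.
have e : T w - x.1 *: w =
  \sum_(y <- [seq (y.1, (y.1 - x.1) *: y.2) | y <- s]) y.2.
  rewrite /w big_cons (linD T_lin) Tx scalerDr opprD addrACA subrr add0r.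
  rewrite (linS T_lin) big_map scaler_sumr -sumrB /=; apply: eq_big_seq => y ys.
  by have [-> _] := hs y (mem_behead (s := x :: s) ys); rewrite scalerBl.
rewrite e; apply/eqP; apply: IH; first by rewrite size_map.
- move=> _ /mapP[y ys ->] /=;
  have [Ty yh] := hs y (mem_behead (s := x :: s) ys).
  by split=> //; rewrite (linZ T_lin) Ty !scalerA mulrC.
- rewrite -e; case: gw => N hN; exists N.
  have Nl := iter_linear N (shifted_linear T_lin h).
  have comm v : iter N (fun u => T u - h *: u) (T v) =
    T (iter N (fun u => T u - h *: u) v).
    elim: N {hN Nl} => // N IHN; rewrite !iterS IHN (linB T_lin) (linZ T_lin).
    by [].
  by rewrite (linB Nl) comm (linZ Nl) hN (lin0 T_lin) scaler0 subr0.
Qed.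

Lemma geigen_sum (h : R[i]) (s : seq (R[i] * M)) :
  (forall x, x \in s -> T x.2 = x.1 *: x.2) ->
  generalized_eigenspace T h (\sum_(x <- s) x.2) ->
  \sum_(x <- s) x.2 = \sum_(x <- s | x.1 == h) x.2.
Proof.
move=> hs gw; rewrite [LHS](bigID (fun x => x.1 == h)) /=.
rewrite -[RHS]addr0; congr (_ + _); rewrite -big_filter.
apply: (@geigen_sum_neq h) => [x|].
  by rewrite mem_filter => /andP[xh xs]; split=> //; apply: hs.
rewrite big_filter.
have -> : \sum_(x <- s | x.1 != h) x.2 =
    \sum_(x <- s) x.2 + (-1) *: \sum_(x <- s | x.1 == h) x.2.
  by rewrite [in RHS](bigID (fun x => x.1 == h)) /= scaleN1r addrAC subrr add0r.
apply: (geigenD T_lin) => //; apply: (geigenZ T_lin); rewrite big_seq_cond.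
elim/big_ind: _ => [|x y|x /andP[xs /eqP e]]; first exact: geigen0.
- exact: geigenD.
- by apply: geigen_eq; rewrite hs // e.
Qed.

End EigenvectorSums.

Section VermaModule.
Context (R : realType) (k : R[i]) (A : Vk_gl11 k) (n e : R[i]) (M : vmodule A).
Context (i : verma_space R -> M).
Hypothesis k0 : k != 0.
Hypothesis HI : induced_module k (verma_act n e) (affine_mode (W := M)) i.

Local Notation Delta := (e / k * (n + e / (2 * k))).
Local Notation L0 := (@vm_Y R A M (vo_conf A) 1).

Let il := ext_linear (ind_ext HI).

Lemma top_annihilated u c (r : int) :
  0 < r -> vm_Y (vk_gen A c) r (i u) = 0.
Proof. exact: (ext_pos (ind_ext HI)). Qed.

Lemma top_zero_mode u c : vm_Y (vk_gen A c) 0 (i u) = i (verma_act n e c u).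
Proof. exact: (ext_zero (ind_ext HI)). Qed.

Lemma L0_top u : L0 (i u) = Delta *: i u.
Proof.
rewrite (conf_mode1_top (@vm_action _ _ M)); last by move=> c r;
  apply: top_annihilated.
rewrite !top_zero_mode -!(linZ il) -!(linD il) -!(linN il) -!(linD il).
rewrite -!(linZ il) -!(linD il); congr i.
by case: u => x y; congr pair; rewrite /= /GRing.scale /=; field.
Qed.

Lemma L0_graded_piece m w :
  graded_piece (affine_mode (W := M)) i m w -> L0 w = (Delta + m%:~R) *: w.
Proof.
have Ll : linear L0 := vact_linr (@vm_action _ _ M) _ _.
have actl a r : linear (vm_Y (vk_gen A a) r) :=
  vact_linr (@vm_action _ _ M) _ _.
elim=> {m w} [m|u|m c x y _ IHx _ IHy|m a r x _ _ IH].
- by rewrite (lin0 Ll) scaler0.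
- by rewrite L0_top addr0.
- by rewrite Ll IHx IHy scalerDr !scalerA mulrC.
- rewrite (L0_gen_commutator k0 (@vm_action _ _ M)) IH (linZ (actl a r)).
  by rewrite -scalerBl intrB addrA.
Qed.

(** By the grading, [h = Delta + m] for an integer [m]. Comparing with a nonzero top vector, of
    weight [Delta], minimality of [h] gives [m <= 0], while pieces of negative degree vanish. Hence
    [m = 0]. *)
Lemma lowest_weight_vector_top w : lowest_conformal_weight_vector w ->
  weight_space Delta w /\ exists u, w = i u.
Proof.
have Ll : linear L0 := vact_linr (@vm_action _ _ M) _ _.
case=> h [[w1 gw1 w1n0] hmin] gw.
have [s [hs sw]] := graded_decomposition HI w.
have hs' x : x \in [seq (Delta + y.1%:~R, y.2) | y <- s] -> L0 x.2 = x.1 *: x.2.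
  by move=> /mapP[y ys ->] /=; apply: L0_graded_piece; apply: hs.
have := @geigen_sum R M L0 Ll h _ hs'; rewrite !big_map /= -sw => /(_ gw) {}sw.
have [w0|wn0] := eqVneq w 0.
  rewrite w0; split; first exact: geigen0.
  by exists 0; rewrite (lin0 il).
have [m hm] : exists m : int, h = Delta + m%:~R.
  apply: contrapT => nm; move/eqP: wn0; apply; rewrite sw big1 // => x /eqP xh.
  by exfalso; apply: nm; exists x.1.
have gpw : graded_piece (affine_mode (W := M)) i m w.
  rewrite sw big_seq_cond.
  elim/big_ind: _ => [|x y|x /andP[xs]]; first exact: GradedZero.
    exact: graded_pieceD.
  rewrite hm (inj_eq (addrI _)) eqr_int => /eqP <-; exact: hs.
(* If the top space maps to zero, the induced module is zero, which contradicts [w != 0]. *)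
have [i0|/existsNP[u /eqP iu]] := pselect (forall u, i u = 0).
  have M0 : forall y, y = 0 :> M.
    apply: (induced_ind HI) => // [c x y -> ->|a r x ->].
      by rewrite scaler0 addr0.
    exact: (lin0 (aff_linear (ind_action HI) a r)).
  by move: wn0; rewrite (M0 w) eqxx.
have [m' e1] : exists m' : nat, Delta = h + m'%:R.
  by apply: hmin iu; apply: geigen_eq; apply: L0_top.
have m0 : m = 0.
  have m_le : m = - m'%:Z.
    have /eqP : (m%:~R : R[i]) = (- m'%:Z)%:~R.
      by rewrite rmorphN /=; apply: (addrI Delta); rewrite -hm e1 addrK.
    by rewrite eqr_int => /eqP.
  case: m' e1 m_le => [//|m'] _ m_le; move: wn0.
  by rewrite (graded_piece_neg HI gpw) ?eqxx // m_le.
split; last exact: (graded_piece0 HI gpw).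
by move: gw; rewrite hm m0 addr0.
Qed.

End VermaModule.

Lemma fsum_ord (V : nmodType) (J : nat) (F : nat -> V) :
  (forall j, (J <= j)%N -> F j = 0) ->
  \sum_(j \in [set: nat]) F j = \sum_(j < J) F j.
Proof.
move=> F0; rewrite fsbig_ord; apply/esym/fsbig_widen => // j [_ /= /negP].
by rewrite -leqNgt => /F0.
Qed.

(** * Four-point functions *)

Section Correlator.
Context (R : realType) (k : R[i]) (A : Vk_gl11 k) (V X W : vmodule A).
Context (B : parity_reversal X -> V -> R[i]).
Context (Y1 : V -> R[i] -> nat -> W -> V).
Hypothesis HB : contragredient_pairing B.
Hypothesis HY1 : even_intertwining_operator Y1.

(** The value of [<u0, Y1(u1, z1) w>] at [z1 = 1]: all powers of [z1] are 1, and [log z1 = 0] leaves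
    only the logarithmic power 0. *)
Definition correlator u0 u1 w := \sum_(s \in [set: R[i]]) B u0 (Y1 u1 s 0 w).

Let Bl u0 : linear (B u0 : V -> R[i]^o) := cp_linr HB u0.

Lemma pairing_negative_mode p u0 a (r : int) : parity p u0 ->
  vm_Y (vk_gen A a) (- r) u0 = 0 -> forall y, B u0 (affine_mode a r y) = 0.
Proof.
move=> pu0 au0 y; have := cp_invariant HB a (- r) y pu0.
have -> : affine_mode a (- r) u0 = 0 by exact: au0.
have -> : B 0 y = 0.
  by have /esym := cp_linl HB y 1 0 0;
    rewrite scaler0 addr0 mul1r => /(canRL (addrK _)); rewrite subrr.
rewrite opprK => /esym/eqP; rewrite mulf_eq0 oppr_eq0 signr_eq0.
by move=> /eqP.
Qed.

Section EigenArguments.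
Context (u0 : parity_reversal X) (h0 : R[i]) (q : bool) (u1 : V) (h1 : R[i]).
Hypothesis wu0 : weight_space h0 u0.
Hypothesis pu1 : parity q u1.
Hypothesis Lu1 : vm_Y (vo_conf A) 1 u1 = h1 *: u1.

(** The mode [s] sends weight [h] to [h1 + h - s - 1], which must equal [h0] for a nonzero pairing.
    Each of the finitely many weights occurring in [w] thus allows one [s]. *)
Lemma correlator_support w : exists D : {fset R[i]},
  forall s, s \notin D -> B u0 (Y1 u1 s 0 w) = 0.
Proof.
have [sq [hsq ->]] := vm_graded w.
exists [fset h1 + x.1 - 1 - h0 | x in sq]%fset => s sD.
rewrite (linS (io_linr HY1 _ _ _)) (linS (Bl u0)) big_seq big1 // => x xs.
apply: (cp_weight HB wu0 (io_weight HY1 s 0 pu1 Lu1 (hsq x xs))).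
apply: contra sD => /eqP e; apply/imfsetP; exists x => //=; rewrite e; ring.
Qed.

Lemma correlator_linear : linear (correlator u0 u1 : W -> R[i]^o).
Proof.
move=> c x y; rewrite /correlator.
have [D1 h_1] := correlator_support x; have [D2 h_2] := correlator_support y.
rewrite !(@fsbigTE _ _ _ _ (D1 `|` D2)%fset); first last.
1-3: move=> s; rewrite inE negb_or => /andP[/h_1 e1 /h_2 e2];
  by rewrite ?(io_linr HY1) ?(Bl u0) ?e1 ?e2 ?scaler0 ?addr0.
rewrite scaler_sumr -big_split; apply: eq_bigr => s _ /=.
by rewrite (io_linr HY1) (Bl u0).
Qed.

End EigenArguments.

(** Positive modes kill [u1], so the commutator with [a_r] keeps only the term of [a_0 u1]. It moves
    the mode index by [r], and this shift is harmless in a sum over all [s]. *)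
Lemma correlator_mode u0 u1 a (r : int) w : parity false u1 ->
  (forall c (t : int), 0 < t -> vm_Y (vk_gen A c) t u1 = 0) ->
  (forall y, B u0 (affine_mode a r y) = 0) ->
  correlator u0 u1 (vm_Y (vk_gen A a) r w)
  = - correlator u0 (vm_Y (vk_gen A a) 0 u1) w.
Proof.
move=> pu1 top B0; rewrite /correlator -mulN1r mulr_fsumr.
rewrite [RHS](@reindex_fsbigT _ _ _ _ _ (fun s : R[i] => s + r%:~R));
  last first.
  by exists (fun s : R[i] => s - r%:~R) => s; [exact: addrK|exact: subrK].
apply: eq_fsbigr => s _.
have [N hN] := io_commutator HY1 r s 0 w (vk_gen_parity A a) pu1.
have := hN N.+1 (leqnSn _).
rewrite andbF expr0 scale1r big_ord_recl big1 ?addr0; last first.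
  by move=> i _; rewrite top // (lin0 (io_linl HY1 _ _ _)) scaler0.
rewrite gbinn0 scale1r /= subr0 mulN1r => <-.
by rewrite (linB (Bl u0)) B0 sub0r opprK.
Qed.

Lemma correlator_scale u0 u1 c w :
  correlator u0 (c *: u1) w = c * correlator u0 u1 w.
Proof.
rewrite /correlator mulr_fsumr; apply: eq_fsbigr => s _.
by rewrite (linZ (io_linl HY1 _ _ _)) (linZ (Bl u0)).
Qed.

End Correlator.

Lemma cexp0 (R : realType) : cexp (0 : R[i]) = 1.
Proof. by rewrite /cexp /= expR0 cos0 sin0 mulr1 mulr0. Qed.

Section FourPoint.
Context (R : realType) (k n e : R[i]) (A : Vk_gl11 k) (V X W : vmodule A).
Context (iV : verma_space R -> V) (iX : verma_space R -> X).
Context (B : parity_reversal X -> V -> R[i]).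
Context (Y1 : V -> R[i] -> nat -> W -> V).
Context (Y2 : parity_reversal X -> R[i] -> nat -> V -> W).
Hypothesis k0 : k != 0.
Hypothesis HV : induced_module k (verma_act n e) (affine_mode (W := V)) iV.
Hypothesis HX :
  induced_module k (verma_act (- n) (- e)) (affine_mode (W := X)) iX.
Hypothesis HB : contragredient_pairing B.
Hypothesis HY1 : even_intertwining_operator Y1.
Hypothesis HY2 : even_intertwining_operator Y2.

Local Notation gen := (vk_gen A).
Local Notation D := (2 * (e / k * (n + e / (2 * k)))).
Local Notation x := (e / k).
Local Notation hw := ((1, 0) : verma_space R).
Local Notation lw := ((0, 1) : verma_space R).
Local Notation v1 := (iV hw).
Local Notation v3 := (iV lw).
Local Notation v2 := (iX hw : parity_reversal X).
Local Notation u0 := (iX lw : parity_reversal X).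

Let iVl := ext_linear (ind_ext HV).
Let iXl := ext_linear (ind_ext HX).

Let f := correlator B Y1 u0 v1.
Let act (a : gl11) (r : int) := @vm_Y R A W (gen a) r.

Lemma verma_zero_modes (n' e' : R[i]) :
  [/\ [/\ verma_act n' e' gN hw = (n' + 2^-1) *: hw, verma_act n' e' gE hw =
    e' *: hw,
       verma_act n' e' gPsip hw = 0 & verma_act n' e' gPsim hw = lw] &
      [/\ verma_act n' e' gN lw = (n' - 2^-1) *: lw, verma_act n' e' gE lw =
        e' *: lw,
       verma_act n' e' gPsip lw = e' *: hw & verma_act n' e' gPsim lw = 0]].
Proof.
by split; split; rewrite /=; congr pair; rewrite /GRing.scale /= ?mulr1 ?mulr0.
Qed.

Lemma u0_parity : parity false u0.
Proof. exact: (@ext_even _ _ _ _ _ _ (ind_ext HX) true lw). Qed.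

Lemma v2_parity : parity true v2.
Proof. exact: (@ext_even _ _ _ _ _ _ (ind_ext HX) false hw). Qed.

Lemma v1_parity : parity false v1.
Proof. exact: (@ext_even _ _ _ _ _ _ (ind_ext HV) false hw). Qed.

Lemma v3_parity : parity true v3.
Proof. exact: (@ext_even _ _ _ _ _ _ (ind_ext HV) true lw). Qed.

Lemma f_linear : linear (f : W -> R[i]^o).
Proof.
apply: (correlator_linear HB HY1 _ v1_parity (L0_top k0 HV hw)).
by apply: geigen_eq; apply: (L0_top k0 HX lw).
Qed.

Lemma f_mode a (r : int) w : r < 0 ->
  f (act a r w) = - correlator B Y1 u0 (iV (verma_act n e a hw)) w.
Proof.
move=> r0; rewrite -(top_zero_mode HV); apply: (correlator_mode HB HY1).
- exact: v1_parity.
- by move=> c t; apply: (top_annihilated HV).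
- apply: (pairing_negative_mode HB u0_parity).
  by apply: (top_annihilated HX); rewrite oppr_gt0.
Qed.

Lemma f_N (r : int) w : r < 0 -> f (act gN r w) = - (n + 2^-1) * f w.
Proof.
move=> r0; rewrite f_mode //; have [[-> _ _ _] _] := verma_zero_modes n e.
by rewrite (linZ iVl) (correlator_scale HB HY1) mulNr.
Qed.

Lemma f_E (r : int) w : r < 0 -> f (act gE r w) = - e * f w.
Proof.
move=> r0; rewrite f_mode //; have [[_ -> _ _] _] := verma_zero_modes n e.
by rewrite (linZ iVl) (correlator_scale HB HY1) mulNr.
Qed.

Lemma f_Psip (r : int) w : r < 0 -> f (act gPsip r w) = 0.
Proof.
move=> r0; rewrite f_mode //; have [[_ _ -> _] _] := verma_zero_modes n e.
rewrite -(scale0r (0 : verma_space R)) (linZ iVl) (correlator_scale HB HY1).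
by rewrite mul0r oppr0.
Qed.

(* As [psi^-_0] also kills [u0], it acts under [f] exactly like the negative
   modes of [psi^-]. *)
Lemma f_Psim (r : int) w : r < 0 -> f (act gPsim r w) = f (act gPsim 0 w).
Proof.
move=> r0; rewrite f_mode // -(top_zero_mode HV).
symmetry; apply: (correlator_mode HB HY1).
- exact: v1_parity.
- by move=> c t; apply: (top_annihilated HV).
- apply: (pairing_negative_mode HB u0_parity).
  rewrite oppr0; have := top_zero_mode HX lw gPsim.
  have [_ [_ _ _ ->]] := verma_zero_modes (- n) (- e).
  by rewrite (lin0 iXl).
Qed.

(* Telescoping in [s] removes the infinite sum over modes; this is the
   formal counterpart of multiplying by [1 - z]. *)
Lemma f_normal_product a (Q : W -> R[i]) p u2 y s j :
  parity p (u2 : parity_reversal X) ->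
  (forall c (r : int), 0 < r -> vm_Y (gen c) r (iV y) = 0) ->
  (forall r w, r < 0 -> f (act a r w) = Q w) ->
  f (Y2 (vm_Y (gen a) (-1) u2) s j (iV y))
  - f (Y2 (vm_Y (gen a) (-1) u2) (s + 1) j (iV y))
  = Q (Y2 u2 s j (iV y))
    + (-1) ^+ (gl11_odd a && p) * (f (Y2 u2 (s - 1) j (iV (verma_act n e a y)))
                        - f (Y2 u2 s j (iV (verma_act n e a y)))).
Proof.
move=> pu top fQ.
have fl := f_linear.
have sum_eq t : exists N, forall I, (N <= I)%N ->
    f (Y2 (vm_Y (gen a) (-1) u2) t j (iV y)) =
    \sum_(i < I) Q (Y2 u2 (t + i%:R) j (iV y)) +
    (-1) ^+ (gl11_odd a && p) * f (Y2 u2 (t - 1) j (iV (verma_act n e a y))).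
  have [N hN] := io_normal_product HY2 t j (iV y) (vk_gen_parity A a) pu.
  exists N.+1 => -[//|I] NI;
    rewrite (hN _ (ltnW NI)) (linS fl) -top_zero_mode //.
  have -> : \sum_(i < I.+1) Q (Y2 u2 (t + i%:R) j (iV y)) =
      \sum_(i < I.+1) f (vm_Y (gen a) (-1 - i%:Z) (Y2 u2 (t + i%:R) j (iV y))).
    by apply: eq_bigr => i _; rewrite -(fQ (-1 - i%:Z)).
  under eq_bigr do rewrite (linD fl).
  rewrite big_split /=; congr (_ + _).
  rewrite big_ord_recl big1 ?addr0 /=.
    by rewrite (linZ fl) subr0.
  move=> i _; rewrite top // (lin0 (io_linr HY2 _ _ _)) scaler0.
  exact: (lin0 fl).
have [N1 h1] := sum_eq s; have [N2 h2] := sum_eq (s + 1).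
(* The sum at [s] is taken one term longer than the sum at [s + 1], so that exactly its term [i = 0]
   survives in the difference. *)
rewrite (h1 (N1 + N2).+1) ?(h2 (N1 + N2)%N) ?leq_addl //; last first.
  by rewrite (leq_trans (leq_addr N2 N1)).
rewrite big_ord_recl addr0 addrK.
have -> : \sum_(i < N1 + N2) Q (Y2 u2 (s + (lift ord0 i)%:R) j (iV y)) =
    \sum_(i < N1 + N2) Q (Y2 u2 (s + 1 + i%:R) j (iV y)).
  by apply: eq_bigr => i _; rewrite lift0 -addrA -natr1 [i%:R + 1]addrC.
ring.
Qed.

Definition phi_coef s j := f (Y2 v2 s j v3).
Definition G_coef s j := f (Y2 u0 s j v1).

Let topV y c (r : int) := @top_annihilated _ _ _ _ _ _ _ HV y c r.
Let topX y c (r : int) := @top_annihilated _ _ _ _ _ _ _ HX y c r.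

(** The coefficient of [z^(-s-1) (log z)^j] in the first equation of the system divided by [z]. A
    factor [z] turns index [s + 1] into [s], and [z^-1] turns [s - 1] into [s]. The function [g]
    enters through [psi^+_(-1) psi^-_0] in the formula for [L_(-1) v']. *)
Lemma phi_recurrence s j :
  - s * phi_coef (s - 1) j + j.+1%:R * phi_coef (s - 1) j.+1
    - (- (s + 1) * phi_coef s j + j.+1%:R * phi_coef s j.+1)
  = D * phi_coef s j + (x - D) * (phi_coef (s - 1) j - phi_coef s j)
    - x * (G_coef (s - 1) j - G_coef s j).
Proof.
have fl := f_linear.
have der t : - t * phi_coef (t - 1) j + j.+1%:R * phi_coef (t - 1) j.+1 =
    f (Y2 (vm_Y (vo_conf A) 0 v2) t j v3).
  by rewrite (io_derivative HY2) (linD fl) !(linZ fl).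
have := der (s + 1); rewrite addrK => ->; rewrite der {der}.
have [[zN zE zp zm] _] := verma_zero_modes (- n) (- e).
have [_ [yN yE yp ym]] := verma_zero_modes n e.
have cE : vm_Y (vo_conf A) 0 (iX hw) =
    k^-1 *: (- e *: vm_Y (gen gN) (-1) (iX hw)
      + (- n + 2^-1) *: vm_Y (gen gE) (-1) (iX hw)
      - vm_Y (gen gPsip) (-1) (iX lw))
    + ((k ^+ 2)^-1 * - e) *: vm_Y (gen gE) (-1) (iX hw).
  have Xl a r := vact_linr (@vm_action _ _ X) (gen a) r.
  rewrite (conf_mode0_top k0 (@vm_action _ _ X) (topX hw)) !(top_zero_mode HX).
  rewrite zN zE zp zm (lin0 iXl) !(linZ iXl) !(linZ (Xl _ _)) (lin0 (Xl _ _)).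
  by rewrite addr0 scalerA.
have K t : f (Y2 (vm_Y (vo_conf A) 0 v2) t j v3) =
    k^-1 * (- e * f (Y2 (vm_Y (gen gN) (-1) v2) t j v3)
      + (- n + 2^-1) * f (Y2 (vm_Y (gen gE) (-1) v2) t j v3)
      - f (Y2 (vm_Y (gen gPsip) (-1) u0) t j v3))
    + (k ^+ 2)^-1 * - e * f (Y2 (vm_Y (gen gE) (-1) v2) t j v3).
  have Yl := io_linl HY2 t j v3.
  rewrite [vm_Y _ _ _]cE (linD Yl) !(linZ Yl) (linB Yl) (linD Yl) !(linZ Yl).
  by rewrite (linD fl) !(linZ fl) (linB fl) (linD fl) !(linZ fl).
have fY u t c y : f (Y2 u t j (iV (c *: y))) = c * f (Y2 u t j (iV y)).
  by rewrite (linZ iVl) (linZ (io_linr HY2 _ _ _)) (linZ fl).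
have hN := f_normal_product s j v2_parity (topV lw) f_N.
have hE := f_normal_product s j v2_parity (topV lw) f_E.
have hp := f_normal_product s j u0_parity (topV lw) f_Psip.
rewrite yN !fY /= mul1r in hN; rewrite yE !fY /= mul1r in hE.
rewrite yp !fY /= mul1r in hp.
rewrite !K /phi_coef /G_coef (canRL (subrK _) hN) (canRL (subrK _) hE).
by rewrite (canRL (subrK _) hp); field.
Qed.

(** The same coefficient of the second equation. Here [psi^-_(-1) psi^+_0], applied to [psi^- v'],
    leads back to [v'] and so to [phi]. *)
Lemma G_recurrence s j :
  - s * G_coef (s - 1) j + j.+1%:R * G_coef (s - 1) j.+1
    - (- (s + 1) * G_coef s j + j.+1%:R * G_coef s j.+1)
  = D * G_coef s j + x * phi_coef (s - 1) j
    - (D + x) * (G_coef (s - 1) j - G_coef s j).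
Proof.
have fl := f_linear.
have der t : - t * G_coef (t - 1) j + j.+1%:R * G_coef (t - 1) j.+1 =
    f (Y2 (vm_Y (vo_conf A) 0 u0) t j v1).
  by rewrite (io_derivative HY2) (linD fl) !(linZ fl).
have := der (s + 1); rewrite addrK => ->; rewrite der {der}.
have [_ [zN zE zp zm]] := verma_zero_modes (- n) (- e).
have [[yN yE yp ym] _] := verma_zero_modes n e.
have cE : vm_Y (vo_conf A) 0 (iX lw) =
    k^-1 *: (- e *: vm_Y (gen gN) (-1) (iX lw)
      + (- n - 2^-1) *: vm_Y (gen gE) (-1) (iX lw)
      + - e *: vm_Y (gen gPsim) (-1) (iX hw))
    + ((k ^+ 2)^-1 * - e) *: vm_Y (gen gE) (-1) (iX lw).
  have Xl a r := vact_linr (@vm_action _ _ X) (gen a) r.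
  rewrite (conf_mode0_top k0 (@vm_action _ _ X) (topX lw)) !(top_zero_mode HX).
  rewrite zN zE zp zm (lin0 iXl) !(linZ iXl) !(linZ (Xl _ _)) (lin0 (Xl _ _)).
  by rewrite subr0 scalerA.
have K t : f (Y2 (vm_Y (vo_conf A) 0 u0) t j v1) =
    k^-1 * (- e * f (Y2 (vm_Y (gen gN) (-1) u0) t j v1)
      + (- n - 2^-1) * f (Y2 (vm_Y (gen gE) (-1) u0) t j v1)
      + - e * f (Y2 (vm_Y (gen gPsim) (-1) v2) t j v1))
    + (k ^+ 2)^-1 * - e * f (Y2 (vm_Y (gen gE) (-1) u0) t j v1).
  have Yl := io_linl HY2 t j v1.
  rewrite [vm_Y _ _ _]cE (linD Yl) !(linZ Yl) (linD Yl) (linD Yl) !(linZ Yl).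
  by rewrite (linD fl) !(linZ fl) (linD fl) (linD fl) !(linZ fl).
have fY u t c y : f (Y2 u t j (iV (c *: y))) = c * f (Y2 u t j (iV y)).
  by rewrite (linZ iVl) (linZ (io_linr HY2 _ _ _)) (linZ fl).
have hN := f_normal_product s j u0_parity (topV hw) f_N.
have hE := f_normal_product s j u0_parity (topV hw) f_E.
have hm := f_normal_product s j v2_parity (topV hw) f_Psim.
(* The zero mode left over by [f_Psim] is commuted through [Y2(v', z)]. The minus sign in front of
   [phi] comes from [v'] being odd. *)
have fm : f (act gPsim 0 (Y2 v2 s j v1)) = G_coef s j - phi_coef s j.
  have [N hN'] := io_commutator HY2 0 s j v1 (vk_gen_parity A gPsim) v2_parity.
  have := hN' N.+1 (leqnSn _).
  rewrite big_ord_recl big1 ?addr0; last first.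
    by move=> i _; rewrite gbin00 scale0r.
  rewrite gbinn0 scale1r /= ?addr0 ?subr0 ?addr0 expr1 scaleN1r opprK.
  rewrite (top_zero_mode HV) ym => /(canRL (addrK _)).
  have -> : vm_Y (gen gPsim) 0 (iX hw) = iX lw by rewrite (top_zero_mode HX) /=.
  by rewrite /act => ->; rewrite (linB fl).
rewrite yN !fY /= mul1r in hN; rewrite yE !fY /= mul1r in hE.
rewrite fm ym /= in hm.
rewrite !K (canRL (subrK _) hN) (canRL (subrK _) hE) (canRL (subrK _) hm).
by rewrite /phi_coef /G_coef; field.
Qed.

Lemma coef_log_bound s : exists J, forall j, (J <= j)%N ->
  [/\ Y2 v2 s j v3 = 0, phi_coef s j = 0 & G_coef s j = 0].
Proof.
have [J1 h1] := io_log HY2 v2 s v3; have [J2 h2] := io_log HY2 u0 s v1.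
exists (maxn J1 J2) => j; rewrite geq_max => /andP[/h1 e1 /h2 e2].
by rewrite /phi_coef /G_coef e1 e2 (lin0 f_linear).
Qed.

Lemma coef_truncation s : exists N, forall m j, (N <= m)%N ->
  phi_coef (s + m%:R) j = 0 /\ G_coef (s + m%:R) j = 0.
Proof.
have [N1 h1] := io_trunc HY2 v2 s v3; have [N2 h2] := io_trunc HY2 u0 s v1.
exists (maxn N1 N2) => m j; rewrite geq_max => /andP[/(h1 _ j) e1 /(h2 _ j) e2].
by rewrite /phi_coef /G_coef e1 e2 (lin0 f_linear).
Qed.

(** The part of [v0] along [v'] is odd and pairs to zero with the even vector obtained from [Y1],
    leaving the coefficient [c2] of [psi^- v']. *)
Lemma product_termE c1 c2 l s J : (forall j, (J <= j)%N -> Y2 v2 s j v3 = 0) ->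
  product_term B Y1 Y2 (iX (c1, c2) : parity_reversal X) v1 0 v2 l v3 s =
  c2 * \sum_(j < J) cexp (- (s + 1) * l) * l ^+ j * phi_coef s j.
Proof.
have fl := f_linear.
move=> hJ; rewrite /product_term /io_pairing.
have -> : io_term Y2 v2 l v3 s =
  \sum_(j < J) (cexp (- (s + 1) * l) * l ^+ j) *: Y2 v2 s j v3.
  by rewrite /io_term (@fsum_ord _ J) // => j /hJ ->; rewrite scaler0.
set w := \sum_(j < J) _.
have pw : parity false w.
  rewrite /w; elim/big_ind: _ => [|y z py pz|j _]; first exact: parity0.
    by rewrite -[y]scale1r; apply: parityP.
  rewrite -[_ *: _]addr0; apply: parityP; last exact: parity0.
  exact: (io_even HY2 _ _ v2_parity v3_parity).
transitivity (c2 * f w); last first.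
  by congr (_ * _); rewrite /w (linS fl); apply: eq_bigr => j _;
    rewrite (linZ fl).
rewrite /f /correlator mulr_fsumr; apply: eq_fsbigr => t _.
have -> : io_term Y1 v1 0 w t = Y1 v1 t 0 w.
  rewrite /io_term (@fsum_ord _ 1%N); last first.
    by move=> [//|j] _; rewrite expr0n mulr0 scale0r.
  by rewrite big_ord1 mulr0 cexp0 expr0 mulr1 scale1r.
have -> : iX (c1, c2) = c1 *: iX hw + c2 *: iX lw.
  rewrite -!(linZ iXl) -(linD iXl); congr iX.
  by congr pair; rewrite /= /GRing.scale /= ?mulr1 ?mulr0 ?addr0 ?add0r.
have z0 : B 0 (Y1 v1 t 0 w) = 0.
  have /esym := cp_linl HB (Y1 v1 t 0 w) 1 0 0.
  by rewrite scaler0 addr0 mul1r => /(canRL (addrK _)); rewrite subrr.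
rewrite (cp_linl HB) -[c2 *: _ in LHS]addr0 (cp_linl HB) z0 addr0.
by rewrite (cp_even HB v2_parity (io_even HY1 t 0 v1_parity pw)) // mulr0 add0r.
Qed.

End FourPoint.

(** * Formal logarithmic solutions of the first-order system *)

Section FormalSolutions.
Context (R : realType) (D x : R[i]) (phi G : R[i] -> nat -> R[i]).
Hypothesis phi_rec : forall s j,
  - s * phi (s - 1) j + j.+1%:R * phi (s - 1) j.+1
    - (- (s + 1) * phi s j + j.+1%:R * phi s j.+1)
  = D * phi s j + (x - D) * (phi (s - 1) j - phi s j) - x * (G (s - 1) j - G s
    j).
Hypothesis G_rec : forall s j,
  - s * G (s - 1) j + j.+1%:R * G (s - 1) j.+1
    - (- (s + 1) * G s j + j.+1%:R * G s j.+1)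
  = D * G s j + x * phi (s - 1) j - (D + x) * (G (s - 1) j - G s j).
Hypothesis log_bound :
  forall s, exists J, forall j, (J <= j)%N -> phi s j = 0 /\ G s j = 0.
Hypothesis truncation : forall s, exists N, forall m j, (N <= m)%N ->
  phi (s + m%:R) j = 0 /\ G (s + m%:R) j = 0.

(** Descending in [j], the coefficients at [s - 1] solve a homogeneous 2 by 2 linear system of
    determinant [(D - s) ^+ 2]. The two displayed combinations are the rows of its adjugate. Keeping
    [j0] general serves both the vanishing of whole levels and the bound on the logarithmic
    degree. *)
Lemma nonresonant_step s j0 : s != D ->
  (forall j, (j0 <= j)%N -> phi s j = 0 /\ G s j = 0) ->
  forall j, (j0 <= j)%N -> phi (s - 1) j = 0 /\ G (s - 1) j = 0.
Proof.
move=> sD hs j; have [J hJ] := log_bound (s - 1).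
have [d] := ubnP (J - j)%N; elim: d j => // d IH j hd jj0.
have [Jj|jJ] := leqP J j; first exact: hJ.
have [p1 g1] : phi (s - 1) j.+1 = 0 /\ G (s - 1) j.+1 = 0.
  apply: IH; last exact: leqW.
  by rewrite -ltnS; apply: leq_trans hd; rewrite ltnS subnS prednK // subn_gt0.
have [p0 g0] := hs j jj0; have [p2 g2] := hs j.+1 (leqW jj0).
have := phi_rec s j; have := G_rec s j.
rewrite p0 g0 p1 g1 p2 g2 !mulr0 !addr0 !subr0 !add0r => eG ePhi.
have Ds : D - s != 0 by rewrite subr_eq0 eq_sym.
split; apply: (mulfI (expf_neq0 2 Ds)); rewrite mulr0.
- have -> : (D - s) ^+ 2 * phi (s - 1) j =
    (D - s + x) * (- s * phi (s - 1) j) - x * (- s * G (s - 1) j)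
    + ((D - s + x) * (D - x) + x ^+ 2) * phi (s - 1) j
    + ((D - s + x) * x - x * (D + x)) * G (s - 1) j.
    ring.
  rewrite ePhi eG; ring.
- have -> : (D - s) ^+ 2 * G (s - 1) j =
    x * (- s * phi (s - 1) j) + (D - s - x) * (- s * G (s - 1) j)
    + (x * (D - x) - (D - s - x) * x) * phi (s - 1) j
    + (x * x + (D - s - x) * (D + x)) * G (s - 1) j.
    ring.
  rewrite ePhi eG; ring.
Qed.

(** At [s = D] both equations have the same right side, so the two coefficients agree for every
    [j >= 1]. Since the right side is a multiple of their difference, it vanishes one power of the
    logarithm later. *)
Lemma resonant_step : (forall j, phi D j = 0 /\ G D j = 0) ->
  forall j, (2 <= j)%N -> phi (D - 1) j = 0 /\ G (D - 1) j = 0.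
Proof.
move=> hD.
have eqs j : j.+1%:R * phi (D - 1) j.+1 = x * (phi (D - 1) j - G (D - 1) j) /\
             j.+1%:R * G (D - 1) j.+1 = x * (phi (D - 1) j - G (D - 1) j).
  have [p0 g0] := hD j; have [p1 g1] := hD j.+1.
  have := phi_rec D j; have := G_rec D j.
  rewrite p0 g0 p1 g1 !mulr0 !addr0 !subr0 !add0r => eG ePhi; split.
    by apply: (addrI (- D * phi (D - 1) j)); rewrite ePhi; ring.
  by apply: (addrI (- D * G (D - 1) j)); rewrite eG; ring.
have jn0 j : j.+1%:R != 0 :> R[i] by rewrite pnatr_eq0.
move=> [//|[//|j]] _.
have e : phi (D - 1) j.+1 = G (D - 1) j.+1.
  by have [e1 e2] := eqs j; apply: (mulfI (jn0 j)); rewrite e1 e2.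
have [e1 e2] := eqs j.+1.
by split; apply: (mulfI (jn0 j.+1)); rewrite mulr0 ?e1 ?e2 e subrr mulr0.
Qed.

(** Starting from the truncated range above [s], one descends by unit steps. The resonance [D] is
    never crossed, because that would give [s] the excluded form. *)
Lemma exponent_support s : (forall m : nat, s != D - 1 - m%:R) ->
  forall j, phi s j = 0 /\ G s j = 0.
Proof.
move=> sD; have [N hN] := truncation s.
suff h m : (m <= N)%N ->
  forall j, phi (s + (N - m)%:R) j = 0 /\ G (s + (N - m)%:R) j = 0.
  by move=> j; have := h N (leqnn N) j; rewrite subnn addr0.
elim: m => [_ j|m IH mN j]; first by rewrite subn0; apply: hN.
have e : s + (N - m.+1)%:R = s + (N - m)%:R - 1.
  by rewrite -(subnSK mN) -natr1 addrA addrK.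
rewrite e; apply: (@nonresonant_step _ 0) => // [|j' _];
  last exact: IH (ltnW mN) j'.
apply: contra_neq (sD (N - m.+1)%N) => h; rewrite -h -(subnSK mN) -natr1; ring.
Qed.

Lemma log_degree m j : (2 <= j)%N ->
  phi (D - 1 - m%:R) j = 0 /\ G (D - 1 - m%:R) j = 0.
Proof.
have lvlD : forall j, phi D j = 0 /\ G D j = 0.
  apply: exponent_support => m'; apply/eqP => /(congr1 (fun y => D - y)).
  have -> : D - (D - 1 - m'%:R) = m'.+1%:R by rewrite -natr1; ring.
  by rewrite subrr => /esym/eqP; rewrite pnatr_eq0.
elim: m j => [|m IH] j j2; first by rewrite subr0; apply: resonant_step.
have -> : D - 1 - m.+1%:R = D - 1 - m%:R - 1 by rewrite -natr1; ring.
apply: nonresonant_step j2 => // {j}.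
apply/eqP => /(congr1 (fun y => D - y)).
have -> : D - (D - 1 - m%:R) = m.+1%:R by rewrite -natr1; ring.
by rewrite subrr => /eqP; rewrite pnatr_eq0.
Qed.

(** Multiplication by [z] on coefficient sequences; [theta] below is the Euler operator [z d/dz]. *)
Definition coef_shift (a : nat -> R[i]) m := if m is m'.+1 then a m' else 0.
Definition theta (a : nat -> R[i]) m := m%:R * a m.

(** Index [s = D - 1 - m] is the exponent [- s - 1 = - D + m], so these are the coefficients of the
    factor of [(log z)^j] after [z^(-D)] has been divided out. *)
Definition level_coef (F : R[i] -> nat -> R[i]) j m := F (D - 1 - m%:R) j.

Lemma level_shift j m :
  coef_shift (level_coef phi j) m =
    phi (D - m%:R) j /\ coef_shift (level_coef G j) m = G (D - m%:R) j.
Proof.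
case: m => [|m] /=; last by rewrite /level_coef -natr1 opprD addrCA addrC.
(* For [m = 0] the default value 0 of the shift is correct, since the level [s = D] lies outside the
   support. *)
have [|-> ->] // := @exponent_support (D - 0) _ j => m.
apply/eqP => /(congr1 (fun y => D - y)).
have -> : D - (D - 1 - m%:R) = m.+1%:R by rewrite -natr1; ring.
by rewrite subr0 subrr => /esym/eqP; rewrite pnatr_eq0.
Qed.

Lemma theta_shift a m : coef_shift (theta a) m = (m%:R - 1) * coef_shift a m.
Proof.
by case: m => [|m] /=; rewrite ?mulr0 // /theta -natr1 addrK.
Qed.

Lemma level_phi_rec j m :
  theta (level_coef phi j) m - coef_shift (theta (level_coef phi j)) m =
  x * level_coef phi j m + (D - x) * coef_shift (level_coef phi j) m
  - x * (level_coef G j m - coef_shift (level_coef G j) m)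
  - j.+1%:R * (level_coef phi j.+1 m - coef_shift (level_coef phi j.+1) m).
Proof.
rewrite theta_shift /theta; have [-> ->] := level_shift j m.
have [-> _] := level_shift j.+1 m.
have := phi_rec (D - m%:R) j; rewrite /level_coef.
have -> : D - m%:R - 1 = D - 1 - m%:R by ring.
set A := phi _ _; set A' := phi _ _; set B := phi _ _; set B' := phi _ _.
set C := G _ _; set C' := G _ _ => h.
apply/eqP; rewrite -subr_eq0; move/eqP: h; rewrite -subr_eq0 => /eqP <-.
by apply/eqP; ring.
Qed.

Lemma level_G_rec j m :
  theta (level_coef G j) m - coef_shift (theta (level_coef G j)) m =
  x * level_coef phi j m - x * level_coef G j m + (D + x) * coef_shift
    (level_coef G j) m
  - j.+1%:R * (level_coef G j.+1 m - coef_shift (level_coef G j.+1) m).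
Proof.
rewrite theta_shift /theta; have [_ ->] := level_shift j m.
have [_ ->] := level_shift j.+1 m.
have := G_rec (D - m%:R) j; rewrite /level_coef.
have -> : D - m%:R - 1 = D - 1 - m%:R by ring.
set A := phi _ _; set B := G _ _; set B' := G _ _; set C := G _ _.
set C' := G _ _ => h.
apply/eqP; rewrite -subr_eq0; move/eqP: h; rewrite -subr_eq0 => /eqP <-.
by apply/eqP; ring.
Qed.

End FormalSolutions.

(** * Unordered sums and power series *)

Section RealGrowth.
Context (R : realType).
Implicit Types (S : nat -> R) (q r K C : R).

Lemma geometric_sum_le q n : 0 <= q -> q < 1 ->
  \sum_(i < n) q ^+ i <= (1 - q)^-1.
Proof.
move=> q0 q1; have d0 : 0 < 1 - q by rewrite subr_gt0.
rewrite -[leRHS]mul1r ler_pdivlMr // mulrC.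
have -> : (1 - q) * \sum_(i < n) q ^+ i = 1 - q ^+ n.
  by rewrite -[RHS]opprB subrX1 -mulNr opprB.
by rewrite gerBl exprn_ge0.
Qed.

Lemma mulrn_geometric_le q m : 0 <= q -> q < 1 -> m%:R * q ^+ m <= (1 - q)^-1.
Proof.
move=> q0 q1; apply: le_trans (geometric_sum_le m q0 q1).
have -> : m%:R * q ^+ m =
  \sum_(i < m) q ^+ m by rewrite sumr_const card_ord mulr_natl.
by apply: ler_sum => i _; exact: (ler_wiXn2l q0 (ltW q1) (ltnW (ltn_ord i))).
Qed.

(** The hypothesis bounds the ratio of successive terms by [(m + K) / (m + 1 - K)] once [m + 1 > K].
    This tends to 1, so it eventually falls below [1 / r]. *)
Lemma linear_recurrence_growth S K : (forall m, 0 <= S m) -> 0 <= K ->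
  (forall m, m.+1%:R * S m.+1 <= m%:R * S m + K * (S m.+1 + S m)) ->
  forall r, 0 < r < 1 -> exists C, forall m, S m * r ^+ m <= C.
Proof.
move=> S0 K0 hS r /andP[r0 r1]; have d0 : 0 < 1 - r by rewrite subr_gt0.
(* From [2 * K < m (1 - r)] follow both [K < m + 1] and [(m + K) r <= m + 1 - K]. *)
pose M := (Num.truncn (2 * K / (1 - r))).+1.
have hM m : (M <= m)%N -> 2 * K < m%:R * (1 - r).
  move=> Mm; rewrite -ltr_pdivrMr //; apply: lt_le_trans (truncnS_gt _) _.
  by rewrite ler_nat.
have step m : (M <= m)%N -> S m.+1 * r <= S m.
  move=> Mm; have hm := hM m Mm; have := hS m.
  have mK : 0 < m.+1%:R - K.
    have := S0 0%N; have : 0 <= r * m%:R by rewrite mulr_ge0 // ltW.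
    rewrite -natr1; nra.
  move=> h; rewrite -(ler_pM2l mK).
  have h1 : (m.+1%:R - K) * S m.+1 <= (m%:R + K) * S m by nra.
  have h2 : (m%:R + K) * r <= m.+1%:R - K by rewrite -natr1; nra.
  rewrite mulrA; apply: le_trans (ler_wpM2r (ltW r0) h1) _.
  by rewrite mulrAC; apply: ler_wpM2r.
exists (\sum_(i < M.+1) S i * r ^+ i).
have small m : (m <= M)%N -> S m * r ^+ m <= \sum_(i < M.+1) S i * r ^+ i.
  move=> mM; have mM' : (m < M.+1)%N by [].
  rewrite (bigD1 (Ordinal mM')) //= lerDl; apply: sumr_ge0 => i _.
  by rewrite mulr_ge0 // exprn_ge0 // ltW.
elim=> [|m IH]; first exact: small.
have [mM|Mm] := leqP m.+1 M; first exact: small.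
apply: le_trans IH; rewrite exprS mulrA; apply: ler_wpM2r;
  first by rewrite exprn_ge0 // ltW.
exact: step.
Qed.

End RealGrowth.

Section ComplexNorm.
Context (R : realType).
Implicit Types (z w : R[i]).

Lemma normC_normc z : `|z| = (Normc.normc z)%:C%C. Proof. by []. Qed.

Lemma normc_ge0 z : 0 <= Normc.normc z.
Proof. by case: z => a b; apply: sqrtr_ge0. Qed.

Lemma normcX z m : Normc.normc (z ^+ m) = Normc.normc z ^+ m.
Proof. by elim: m => [|m IH];
  rewrite ?expr0 ?Normc.normc1 // !exprS Normc.normcM IH. Qed.

Lemma normc_sum (I : Type) (s : seq I) (P : pred I) (F : I -> R[i]) :
  Normc.normc (\sum_(i <- s | P i) F i) <=
    \sum_(i <- s | P i) Normc.normc (F i).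
Proof.
elim/big_rec2: _ => [|i y w _ h]; first by rewrite Normc.normc0.
by apply: le_trans (le_normcD _ _) _; rewrite lerD2l.
Qed.

Lemma normcB z w : Normc.normc (z - w) = Normc.normc (w - z).
Proof. by rewrite -opprB normcN. Qed.

Lemma normc_real (a : R) : Normc.normc a%:C%C = `|a|.
Proof. by rewrite /Normc.normc /= expr0n /= addr0 sqrtr_sqr. Qed.

Lemma normc_nat m : Normc.normc (m%:R : R[i]) = m%:R.
Proof. by rewrite -(rmorph_nat (real_complex R)) normc_real ger0_norm. Qed.

Lemma Re_le_normc z : `|complex.Re z| <= Normc.normc z.
Proof.
by case: z => a b /=;
  rewrite -sqrtr_sqr ler_sqrt ?addr_ge0 ?sqr_ge0 // lerDl sqr_ge0.
Qed.

Lemma Im_le_normc z : `|complex.Im z| <= Normc.normc z.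
Proof.
by case: z => a b /=;
  rewrite -sqrtr_sqr ler_sqrt ?addr_ge0 ?sqr_ge0 // lerDr sqr_ge0.
Qed.

Lemma normc_le_ReIm z : Normc.normc z <= `|complex.Re z| + `|complex.Im z|.
Proof.
case: z => a b /=; rewrite -[leRHS]ger0_norm ?addr_ge0 // -sqrtr_sqr.
rewrite ler_sqrt ?sqr_ge0 // sqrrD !real_normK ?num_real //.
by rewrite lerD2r lerDl mulrn_wge0 // mulr_ge0.
Qed.

End ComplexNorm.

Section Summation.
Context (R : realType).

Section General.
Context (I : choiceType).
Implicit Types (f g : I -> R[i]).

(** A positive element of [R[i]] is real, so the tolerance may be taken in [R]. *)
Lemma has_csumP f x : has_csum f x <-> forall e : R, 0 < e ->
  exists J0 : {fset I}, forall J : {fset I}, (J0 `<=` J)%fset ->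
    Normc.normc (\sum_(i <- J) f i - x) < e.
Proof.
split=> h e e0.
  have [|J0 hJ] := h e%:C%C; first by rewrite ltcR.
  by exists J0 => J /hJ; rewrite normC_normc ltcR.
have eE : e = (complex.Re e)%:C%C by rewrite RRe_real // gtr0_real.
have e0' : 0 < complex.Re e by move: e0; rewrite {1}eE ltcR.
have [J0 hJ] := h _ e0'; exists J0 => J /hJ; rewrite eE normC_normc ltcR.
by rewrite -eE.
Qed.

Lemma has_csum_unique f x y : has_csum f x -> has_csum f y -> x = y.
Proof.
move=> /has_csumP hx /has_csumP hy; apply: subr0_eq; apply: Normc.eq0_normc.
apply/eqP; rewrite eq_le normc_ge0 andbT leNgt; apply/negP => d0.
have d2 : 0 < Normc.normc (x - y) / 2 by rewrite divr_gt0.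
have [J1 h1] := hx _ d2; have [J2 h2] := hy _ d2.
have := h1 _ (fsubsetUl J1 J2); have := h2 _ (fsubsetUr J1 J2).
set s := \sum_(i <- _) _ => a b.
have : Normc.normc (x - y) <= Normc.normc (s - x) + Normc.normc (s - y).
  by rewrite (normcB s x); apply: le_trans (le_normcD _ _); rewrite addrA subrK.
lra.
Qed.

Lemma csumE f x : has_csum f x -> csum f = x.
Proof. by move=> h; apply: xget_unique => // y /has_csum_unique; apply. Qed.

Lemma has_csum_csum f x : has_csum f x -> has_csum f (csum f).
Proof. by move=> h; rewrite (csumE h). Qed.

Lemma has_csum_eq f g x : f =1 g -> has_csum f x -> has_csum g x.
Proof. by move=> /funext ->. Qed.

Lemma has_csumD f g x y : has_csum f x -> has_csum g y ->
  has_csum (fun i => f i + g i) (x + y).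
Proof.
move=> /has_csumP hx /has_csumP hy; apply/has_csumP => e e0.
have d2 : 0 < e / 2 by rewrite divr_gt0.
have [J1 h1] := hx _ d2; have [J2 h2] := hy _ d2.
exists (J1 `|` J2)%fset => J; rewrite fsubUset => /andP[/h1 a /h2 b].
rewrite big_split /= opprD addrACA.
apply: le_lt_trans (le_normcD _ _) _; lra.
Qed.

Lemma has_csumZ f x c : has_csum f x -> has_csum (fun i => c * f i) (c * x).
Proof.
move=> /has_csumP hx; apply/has_csumP => e e0.
have c1 : 0 < Normc.normc c + 1 by rewrite ltr_wpDl ?normc_ge0.
have d2 : 0 < e / (Normc.normc c + 1) by rewrite divr_gt0.
have [J1 h1] := hx _ d2; exists J1 => J /h1.
rewrite -mulr_sumr -mulrBr Normc.normcM ltr_pdivlMr // => h.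
have := normc_ge0 (\sum_(i <- J) f i - x); nra.
Qed.

Lemma has_csumB f g x y : has_csum f x -> has_csum g y ->
  has_csum (fun i => f i - g i) (x - y).
Proof.
move=> hx hy; have := has_csumD hx (has_csumZ (-1) hy); rewrite mulN1r.
by apply: has_csum_eq => i; rewrite mulN1r.
Qed.

Lemma has_csum_norm_le f x M : has_csum f x ->
  (forall J : {fset I}, Normc.normc (\sum_(i <- J) f i) <= M) ->
  Normc.normc x <= M.
Proof.
move=> /has_csumP hx hM; apply/ler_addgt0Pr => e e0.
have [J hJ] := hx _ e0; have := hJ J (fsubset_refl _).
rewrite normcB => h; have := hM J.
have : Normc.normc x <=
  Normc.normc (x - \sum_(i <- J) f i) + Normc.normc (\sum_(i <- J) f i).
  by apply: le_trans (le_normcD _ _); rewrite subrK.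
lra.
Qed.

End General.

(** This turns a sum over all complex mode indices into one over [nat] once the support is known to
    be [D - 1 - m]. *)
Lemma has_csum_inj (I K : choiceType) (h : K -> I) (f : I -> R[i]) x :
  injective h -> (forall i, (forall j, i != h j) -> f i = 0) ->
  has_csum (fun j => f (h j)) x -> has_csum f x.
Proof.
move=> hinj f0 /has_csumP hx; apply/has_csumP => e e0.
have [J0 hJ0] := hx _ e0.
exists [fset h j | j in J0]%fset => J sub.
have [J' eJ'] : exists J' : {fset K}, forall j, (j \in J') = (h j \in J).
  have fin : finite_set [set j | h j \in J].
    apply: (@finite_preimage _ _ [set` J] h); first by move=> a b _ _;
      apply: hinj.
    exact: finite_fset.
  by exists (fset_set [set j | h j \in J]) => j;
    rewrite in_fset_set // mem_setE.
have -> : \sum_(i <- J) f i = \sum_(j <- J') f (h j).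
  rewrite -(big_map h xpredT f) (bigID (fun i => i \in [seq h j | j <- J'])) /=.
  rewrite [X in _ + X]big_seq_cond [X in _ + X]big1 ?addr0; last first.
    move=> i /andP[iJ iJ']; apply: f0 => j; apply: contra iJ' => /eqP ei.
    by apply/mapP; exists j => //; rewrite eJ' -ei.
  rewrite -big_filter; apply: perm_big; apply: uniq_perm.
  - by rewrite filter_uniq // fset_uniq.
  - by rewrite map_inj_uniq // fset_uniq.
  move=> i; rewrite mem_filter; apply: andb_idr => /mapP[j jJ ->].
  by rewrite -eJ'.
apply: hJ0; apply/fsubsetP => j jJ0; rewrite eJ'.
by apply: (fsubsetP sub); apply/imfsetP; exists j.
Qed.

Lemma fset_nat_sum (V : nmodType) (J : {fset nat}) (g : nat -> V) :
  exists n0, forall n, (n0 <= n)%N ->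
    \sum_(i <- J) g i = \sum_(i < n | val i \in J) g i.
Proof.
exists (\max_(i <- J) i).+1 => n hn.
rewrite -(big_mkord (fun i => i \in J)) -[RHS]big_filter; apply: perm_big.
apply: uniq_perm; rewrite ?fset_uniq ?filter_uniq ?iota_uniq // => i.
rewrite mem_filter mem_index_iota /=; apply/esym/andb_idr => iJ.
apply: leq_trans hn; rewrite ltnS;
  by refine (@leq_bigmax_seq nat (enum_fset J) xpredT (fun i => i) i iJ isT).
Qed.

Section Geometric.
Context (f : nat -> R[i]) (C q : R).
Hypothesis q0 : 0 <= q.
Hypothesis q1 : q < 1.
Hypothesis f_le : forall m, Normc.normc (f m) <= C * q ^+ m.

Let C0 : 0 <= C.
Proof. by have := le_trans (normc_ge0 _) (f_le 0); rewrite expr0 mulr1. Qed.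

Lemma geometric_partial_sum_le n (P : pred nat) N : (forall i, P i ->
  (N <= i)%N) ->
  Normc.normc (\sum_(i < n | P i) f i) <= C * q ^+ N / (1 - q).
Proof.
move=> hP; apply: le_trans (normc_sum _ _ _) _.
apply: (@le_trans _ _ (\sum_(i < n | P i) C * q ^+ i)).
  by apply: ler_sum => i _; apply: f_le.
rewrite -mulr_sumr -mulrA ler_wpM2l // ler_pdivlMr ?subr_gt0 //.
(* This sharper bound telescopes and makes the induction on [n] go through; the maximum covers the
   indices below [N], where no term occurs. *)
apply: (@le_trans _ _ (q ^+ N - q ^+ maxn n N));
  last by rewrite gerBl exprn_ge0.
elim: n => [|n IH]; first by rewrite big_ord0 mul0r max0n subrr.
rewrite big_mkcond big_ord_recr /= -big_mkcond mulrDl.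
apply: le_trans (lerD IH (lexx _)) _ => {IH}.
case: ifP => [/hP Nn|_].
  by rewrite !(maxn_idPl _) ?(leqW Nn) // exprS; lra.
rewrite mul0r addr0 lerD2l lerN2; apply: (ler_wiXn2l q0 (ltW q1)).
by rewrite geq_max leq_maxr (leq_trans (leqnSn n)) ?leq_maxl.
Qed.

Lemma geometric_fset_sum_le (J : {fset nat}) :
  Normc.normc (\sum_(i <- J) f i) <= C / (1 - q).
Proof.
have [n0 /(_ n0 (leqnn _)) ->] := fset_nat_sum J f.
by apply: le_trans (@geometric_partial_sum_le n0 (fun i => i \in J) 0 _) _;
  rewrite ?expr0 ?mulr1.
Qed.

Lemma geometric_csum_le x : has_csum f x -> Normc.normc x <= C / (1 - q).
Proof. by move=> /has_csum_norm_le; apply; apply: geometric_fset_sum_le. Qed.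

Lemma geometric_real_part (P : R[i] ->
  R) : (forall z, `|P z| <= Normc.normc z) ->
  cvgn (series (fun m => P (f m))).
Proof.
move=> hP; apply: normed_cvg.
apply: (@series_le_cvg _ _ (geometric C q)) => [m|m|m|].
- by rewrite /= normr_ge0.
- by rewrite /= mulr_ge0 // exprn_ge0.
- by apply: le_trans (hP _) (f_le _).
- by apply: is_cvg_geometric_series; rewrite ger0_norm.
Qed.

Lemma has_csum_geometric : has_csum f (csum f).
Proof.
have cRe := geometric_real_part (@Re_le_normc R).
have cIm := geometric_real_part (@Im_le_normc R).
(* The candidate limit comes from the completeness of [R], applied to real and imaginary parts. Each
   of them gets [e / 4], and the indices missing from a finite set get [e / 2]. *)
pose S : R[i] := (limn (series (fun m => complex.Re (f m))) +i*
                  limn (series (fun m => complex.Im (f m))))%C.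
apply: (@has_csum_csum _ _ S); apply/has_csumP => e e0.
have e4 : 0 < e / 4 by rewrite divr_gt0.
have /cvgrPdist_lt/(_ _ e4)[M1 _ hM1] := cRe.
have /cvgrPdist_lt/(_ _ e4)[M2 _ hM2] := cIm.
have [N hN] : exists N, C * q ^+ N / (1 - q) < e / 2.
  have : geometric (C / (1 - q)) q @ \oo --> 0.
    by apply: cvg_geometric; rewrite ger0_norm.
  move=> /cvgrPdist_lt /(_ (e / 2)) []; first by rewrite divr_gt0.
  move=> N _ /(_ N (leqnn _)) /=; rewrite sub0r normrN mulrAC => h; exists N.
  exact: le_lt_trans (ler_norm _) h.
exists (fset_set `I_N) => J sub.
have [n0 hn0] := fset_nat_sum J f.
pose n := maxn n0 (maxn M1 M2).
rewrite (hn0 n) ?leq_maxl //.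
have hS : Normc.normc (\sum_(i < n) f i - S) < e / 2.
  apply: le_lt_trans (normc_le_ReIm _) _.
  have rew (P : {additive R[i] ->
    R}) : P (\sum_(i < n) f i) = series (fun m => P (f m)) n.
    by rewrite raddf_sum /series /= big_mkord.
  have n1 : (M1 <= n)%N by rewrite /n !leq_max leqnn orbT.
  have n2 : (M2 <= n)%N by rewrite /n !leq_max leqnn !orbT.
  have := hM1 _ n1; have := hM2 _ n2; rewrite /S !raddfB /= !rew.
  rewrite [X in X < _ -> _]distrC => a; rewrite [X in X < _ -> _]distrC => b;
    lra.
have hT : Normc.normc (\sum_(i < n | val i \notin J) f i) <=
  C * q ^+ N / (1 - q).
  apply: (geometric_partial_sum_le _ (P := fun i => i \notin J)) => i.
  apply: contraR; rewrite -ltnNge => iN; apply: (fsubsetP sub).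
  by rewrite in_fset_set // mem_setE.
have e1 : \sum_(i < n) f i =
  \sum_(i < n | val i \in J) f i + \sum_(i < n | val i \notin J) f i.
  exact: bigID.
have -> : \sum_(i < n | val i \in J) f i - S =
  (\sum_(i < n) f i - S) - \sum_(i < n | val i \notin J) f i by rewrite e1;
    ring.
apply: le_lt_trans (le_normcD _ _) _; rewrite normcN; lra.
Qed.

End Geometric.
End Summation.

(** * Complex derivatives and power series on the unit disk *)

Section ComplexDerivative.
Context (R : realType).

Lemma is_derive_eps (f : Cfield R -> Cfield R) (z d : Cfield R) :
  (forall e : R, 0 < e -> exists2 t : R, 0 < t & forall h : R[i],
     Normc.normc h < t ->
     Normc.normc (f (h + z) - f z - h * d) <= e * Normc.normc h) ->
  is_derive z 1 f d.
Proof.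
move=> hf; suff lim : (fun h : Cfield R => h^-1 *: (f (h *: 1 + z) - f z)) @
  0^' --> d.
  by apply: DeriveDef; [apply/cvg_ex; exists d|apply: cvg_lim].
apply/cvgrPdist_le => /= e e0.
have eE : e = (complex.Re e)%:C%C by rewrite RRe_real // gtr0_real.
have e0' : 0 < complex.Re e by move: e0; rewrite {1}eE ltcR.
have [t t0 ht] := hf _ e0'.
exists (t%:C%C); first by rewrite /= ltcR.
move=> h /=; rewrite sub0r normrN normC_normc ltcR => hh hn0.
have -> : d - h^-1 *: (f (h *: 1 + z) - f z) =
  - h^-1 * (f (h + z) - f z - h * d).
  by rewrite /GRing.scale /= mulr1; field.
rewrite eE normC_normc lecR Normc.normcM normcN Normc.normcV.
have hp : 0 < Normc.normc h.
  rewrite lt_def normc_ge0 andbT; apply: contra hn0 => /eqP/Normc.eq0_normc ->.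
  by [].
rewrite mulrC ler_pdivrMr //; exact: ht.
Qed.

Lemma is_derive_quadratic (f : Cfield R ->
  Cfield R) (z d : Cfield R) (t M : R) :
  0 < t -> (forall h : R[i], Normc.normc h < t ->
     Normc.normc (f (h + z) - f z - h * d) <= Normc.normc h ^+ 2 * M) ->
  is_derive z 1 f d.
Proof.
move=> t0 hM; apply: is_derive_eps => e e0.
have M1 : 0 < `|M| + 1 by rewrite ltr_wpDl.
exists (Num.min t (e / (`|M| + 1))); first by rewrite lt_min t0 divr_gt0.
move=> h; rewrite lt_min ltr_pdivlMr // => /andP[/hM hh he].
apply: le_trans hh _; rewrite expr2 mulrAC; apply: ler_wpM2r;
  first exact: normc_ge0.
have := normc_ge0 h; have := ler_norm M; nra.
Qed.

End ComplexDerivative.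

Section PowerSeries.
Context (R : realType).
Implicit Types (a : nat -> R[i]) (z w : R[i]).

(** Cauchy's bounds for a radius of convergence at least 1. *)
Definition subexponential a := forall r : R, 0 < r < 1 ->
  exists C, forall m, Normc.normc (a m) * r ^+ m <= C.

Definition power_series a z := csum (fun m => a m * z ^+ m).

(** The bound at a radius [r] strictly between [rho] and 1 gives at [rho] the ratio
    [q = rho / r]. *)
Lemma subexponential_geometric a (rho : R) : subexponential a -> 0 <= rho < 1 ->
  exists C q, [/\ 0 <= q, q < 1 & forall m, Normc.normc (a m) * rho ^+ m <=
    C * q ^+ m].
Proof.
move=> ha /andP[r0 r1]; pose r := (1 + rho) / 2.
have rr : 0 < r < 1 by rewrite /r; apply/andP; split; lra.
have [rp rl] := andP rr.
have [C hC] := ha r rr; exists C, (rho / r); split.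
- by rewrite divr_ge0 // ltW.
- by rewrite ltr_pdivrMr // mul1r /r; lra.
move=> m; rewrite expr_div_n mulrA ler_pdivlMr ?exprn_gt0 // mulrAC.
by apply: ler_wpM2r; rewrite ?exprn_ge0.
Qed.

Lemma subexponential_theta a : subexponential a -> subexponential (theta a).
Proof.
move=> ha r rr; have [r0 r1] := andP rr.
have [|C [q [q0 q1 hC]]] := subexponential_geometric (rho := r) ha.
  by rewrite (ltW r0).
exists (C / (1 - q)) => m.
rewrite /theta Normc.normcM normc_nat -mulrA.
have C0 : 0 <= C.
  by have := hC 0%N; rewrite !expr0 !mulr1; apply: le_trans (normc_ge0 _).
apply: le_trans (_ : C * (m%:R * q ^+ m) <= _); last first.
  by apply: ler_wpM2l => //; apply: mulrn_geometric_le.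
by rewrite [leRHS]mulrCA; apply: ler_wpM2l.
Qed.

Lemma power_series_sum a z : subexponential a -> Normc.normc z < 1 ->
  has_csum (fun m => a m * z ^+ m) (power_series a z).
Proof.
move=> ha z1; have [|C [q [q0 q1 hC]]] := subexponential_geometric (rho :=
  Normc.normc z) ha.
  by rewrite normc_ge0.
apply: (has_csum_geometric q0 q1 (C := C)) => m.
by rewrite Normc.normcM normcX.
Qed.

Lemma power_series_shift a z : subexponential a -> Normc.normc z < 1 ->
  has_csum (fun m => coef_shift a m * z ^+ m) (z * power_series a z).
Proof.
move=> ha z1; apply: (has_csum_inj (h := S)); first exact: succn_inj.
  by move=> [|m] h /=; [rewrite mul0r|have := h m; rewrite eqxx].
apply: has_csum_eq (has_csumZ z (power_series_sum ha z1)) => m /=.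
by rewrite exprS mulrCA.
Qed.

(** The first-order Taylor remainder of the monomial [z^m]. Writing [m z^m / z] for the derivative
    avoids a predecessor and matches [theta], for nonzero [z]. *)
Definition power_series_remainder z w m :=
  w ^+ m - z ^+ m - (w - z) * (m%:R * z ^+ m / z).

(** Induction by [r_(m+1) = w r_m + m z^(m-1) (w - z)^2], using [m^2 + m <= (m + 1)^2]. The factor
    [rho ^+ 2] on the left avoids the exponent [m - 2]. *)
Lemma power_series_remainder_le z w m (rho : R) : z != 0 -> 0 < rho ->
  Normc.normc z <= rho -> Normc.normc w <= rho ->
  Normc.normc (power_series_remainder z w m) * rho ^+ 2 <=
    Normc.normc (w - z) ^+ 2 * (m%:R ^+ 2 * rho ^+ m).
Proof.
move=> z0 r0 zr wr; elim: m => [|m IH].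
  by rewrite /power_series_remainder !expr0 !mul0r mulr0 !subrr Normc.normc0
    expr0n /= !mul0r mulr0.
have -> : power_series_remainder z w m.+1 =
    w * power_series_remainder z w m + (m%:R * z ^+ m / z) * (w - z) ^+ 2.
  by rewrite /power_series_remainder !exprS -natr1; field.
have nz : 0 < Normc.normc z.
  rewrite lt_def normc_ge0 andbT; apply: contra_neq z0; exact: Normc.eq0_normc.
have hz : Normc.normc (m%:R * z ^+ m / z) * rho <= m%:R * rho ^+ m.
  case: m {IH} => [|m]; first by rewrite !mul0r Normc.normc0 mul0r.
  rewrite -mulrA Normc.normcM normc_nat -mulrA; apply: ler_wpM2l => //.
  have -> : z ^+ m.+1 / z = z ^+ m by rewrite exprSr mulfK.
  rewrite normcX exprSr.
  apply: ler_pM; rewrite ?exprn_ge0 ?normc_ge0 ?(ltW r0) //.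
  by apply: lerXn2r; rewrite // nnegrE ?normc_ge0 // ltW.
have := le_normcD (w * power_series_remainder z w m) ((m%:R * z ^+ m / z) * (w
  - z) ^+ 2).
rewrite Normc.normcM [Normc.normc (_ * (w - z) ^+ 2)]Normc.normcM normcX.
have N0 := normc_ge0 (w - z); have P0 := exprn_ge0 m (ltW r0).
have w0 := normc_ge0 w; have R0 := normc_ge0 (power_series_remainder z w m).
move: (Normc.normc (w * _ + _)) N0 IH R0 hz => L.
move: (Normc.normc (w - z)) (Normc.normc (power_series_remainder z w m)).
move: (Normc.normc (m%:R * z ^+ m / z)) => c N Rm N0 IH R0 hz tri.
have s1 : Normc.normc w * (Rm * rho ^+ 2) <=
  rho * (N ^+ 2 * (m%:R ^+ 2 * rho ^+ m)).
  by apply: ler_pM; rewrite // mulr_ge0 // exprn_ge0 // ltW.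
have s2 : c * rho * (N ^+ 2 * rho) <= m%:R * rho ^+ m * (N ^+ 2 * rho).
  by apply: ler_wpM2r => //; rewrite mulr_ge0 ?exprn_ge0 // ltW.
have s3 : L * rho ^+ 2 <= (Normc.normc w * Rm + c * N ^+ 2) * rho ^+ 2.
  by apply: ler_wpM2r => //; rewrite exprn_ge0 // ltW.
have s4 : 0 <= (m%:R + 1) * (N ^+ 2 * rho * rho ^+ m).
  by rewrite !mulr_ge0 ?exprn_ge0 ?addr_ge0 // ltW.
rewrite (exprS rho m) -natr1; move: (rho ^+ m) s1 s2 s4 => P s1 s2 s4.
move: (m%:R : R) s1 s2 s4 => M s1 s2 s4; lra.
Qed.

(** Take [rho] halfway between [|z|] and 1; increments below [(1 - |z|) / 2] stay in that disk. The
    remainders then sum to a multiple of [|h|^2], because [theta (theta a)] supplies the factor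
    [m^2] with geometric decay. *)
Lemma is_derive_power_series a (z : Cfield R) : subexponential a -> z != 0 ->
  Normc.normc (z : R[i]) < 1 ->
  is_derive z 1 (power_series a : Cfield R ->
    Cfield R) (power_series (theta a) z / z).
Proof.
move=> ha z0 z1; have hta := subexponential_theta ha.
have htta := subexponential_theta hta.
pose rho := (1 + Normc.normc (z : R[i])) / 2.
have zn := normc_ge0 (z : R[i]).
have rr : 0 <= rho < 1 by rewrite /rho; apply/andP; split; lra.
have r0 : 0 < rho by rewrite /rho; lra.
have zr : Normc.normc (z : R[i]) <= rho by rewrite /rho; lra.
have [C [q [q0 q1 hC]]] := subexponential_geometric htta rr.
apply: (@is_derive_quadratic _ _ _ _ ((1 - Normc.normc (z : R[i])) / 2) (C /
  rho ^+ 2 / (1 - q))).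
  by rewrite divr_gt0 // subr_gt0.
move=> h hh; pose w : R[i] := h + z.
have wr : Normc.normc w <= rho.
  by apply: le_trans (le_normcD _ _) _; rewrite /rho; lra.
have w1 : Normc.normc w < 1 by apply: le_lt_trans wr _; case/andP: rr.
have hz := power_series_sum ha z1; have hw := power_series_sum ha w1.
have ht := power_series_sum hta z1.
have hs : has_csum (fun m => a m * power_series_remainder z w m)
   (power_series a w - power_series a z - h * (power_series (theta a) z / z)).
  have := has_csumB (has_csumB hw hz) (has_csumZ (h / z) ht).
  rewrite (_ : h / z * _ = h * (power_series (theta a) z / z));
    last by rewrite mulrAC -mulrA.
  apply: has_csum_eq => m; rewrite /power_series_remainder /theta /w addrK;
    field.
  exact: z0.
have e : Normc.normc h ^+ 2 * (C / rho ^+ 2 / (1 - q)) =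
    Normc.normc h ^+ 2 / rho ^+ 2 * C / (1 - q) by ring.
rewrite e; apply: (geometric_csum_le q0 q1 _ hs) => m.
rewrite Normc.normcM.
have := power_series_remainder_le m z0 r0 zr wr; rewrite {2}/w addrK => hm.
have hm' : Normc.normc (power_series_remainder z w m) <=
    Normc.normc h ^+ 2 * (m%:R ^+ 2 * rho ^+ m) / rho ^+ 2.
  by rewrite ler_pdivlMr ?exprn_gt0.
apply: le_trans (ler_wpM2l (normc_ge0 _) hm') _.
have := hC m; rewrite /theta !Normc.normcM !normc_nat => hCm.
have e2 : Normc.normc (a m) * (Normc.normc h ^+ 2 * (m%:R ^+ 2 * rho ^+ m) /
  rho ^+ 2) =
   Normc.normc h ^+ 2 / rho ^+ 2 * (m%:R * (m%:R * Normc.normc (a m)) * rho ^+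
     m) by ring.
rewrite e2 -[leRHS]mulrA; apply: ler_wpM2l => //.
by rewrite divr_ge0 ?exprn_ge0 ?normc_ge0 // ltW.
Qed.

End PowerSeries.

(** * Complex exponential and logarithm *)

Section ComplexExponential.
Context (R : realType).

Lemma cexpD (z w : R[i]) : cexp (z + w) = cexp z * cexp w.
Proof.
case: z w => a b [c d]; rewrite /cexp /= expRD cosD sinD.
by apply/eqP; rewrite eq_complex /=; apply/andP; split; apply/eqP; ring.
Qed.

Lemma cexpX (z : R[i]) m : cexp (m%:R * z) = cexp z ^+ m.
Proof.
elim: m => [|m IH]; first by rewrite mul0r cexp0 expr0.
by rewrite -natr1 mulrDl mul1r cexpD IH exprSr.
Qed.

Lemma real_derive_eps (f : R -> R) (u d : R) : is_derive u 1 f d ->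
  forall e : R, 0 < e -> exists2 t : R, 0 < t & forall h : R,
    `|h| < t -> `|f (h + u) - f u - h * d| <= e * `|h|.
Proof.
case=> df <- e e0; have /cvgrPdist_le/(_ _ e0)[t t0 ht] := df.
exists t => // h hh; have [->|hn0] := eqVneq h 0.
  by rewrite add0r subrr mul0r subrr normr0 mulr0.
have := ht h; rewrite /= sub0r normrN => /(_ hh hn0).
rewrite /GRing.scale /= mulr1 => hd.
have -> : f (h + u) - f u - h * 'D_1 f u =
  - (h * ('D_1 f u - h^-1 * (f (h + u) - f u))) by field.
rewrite normrN normrM mulrC ler_pM2r ?normr_gt0 //.
Qed.

Lemma cexp_derive_eps0 (e : R) : 0 < e ->
  exists2 t : R, 0 < t & forall h : R[i],
  Normc.normc h < t -> Normc.normc (cexp h - 1 - h) <= e * Normc.normc h.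
Proof.
(* The real part of the error costs [3 * d * H] and the imaginary part [2 * d * H], hence the 5. The
   later radius [d / 4] makes the product of two increments, at most [4 * H ^+ 2], smaller than
   [d * H]. *)
move=> e0; pose d := Num.min (e / 5) 1.
have d0 : 0 < d by rewrite lt_min divr_gt0 //=.
have d1 : d <= 1 by rewrite /d ge_min lexx orbT.
have d5 : d * 5 <= e by rewrite -ler_pdivlMr // /d ge_min lexx.
have [t1 t10 h1] := real_derive_eps (is_derive_expR (0 : R)) d0.
have [t2 t20 h2] := real_derive_eps (is_derive_cos (0 : R)) d0.
have [t3 t30 h3] := real_derive_eps (is_derive_sin (0 : R)) d0.
exists (Num.min (Num.min t1 t2) (Num.min t3 (d / 4))).
  by rewrite !lt_min t10 t20 t30 divr_gt0.
move=> h; rewrite !lt_min => /andP[/andP[ht1 ht2] /andP[ht3 ht4]].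
have ha := Re_le_normc h; have hb := Im_le_normc h.
have H0 := normc_ge0 h.
set a := complex.Re h in ha; set b := complex.Im h in hb.
set H := Normc.normc h in ha hb ht1 ht2 ht3 ht4 H0 *.
have := h1 a (le_lt_trans ha ht1); have := h2 b (le_lt_trans hb ht2).
have := h3 b (le_lt_trans hb ht3).
rewrite !addr0 expR0 cos0 sin0 !subr0 oppr0 mulr0 !mulr1 subr0 => hs hc he.
have hcb : `|cos b| <= 1 by exact: cos_max.
apply: le_trans (normc_le_ReIm _) _; rewrite !raddfB /= -/a -/b.
have -> : expR a * cos b - 1 - a =
  (expR a - 1 - a) * cos b + (1 + a) * (cos b - 1) by ring.
have -> : expR a * sin b - 0 - b = (expR a - 1) * sin b + (sin b - b) by ring.
have a1 : `|a| <= 1 by apply: le_trans ha _; lra.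
have hRe : `|(expR a - 1 - a) * cos b + (1 + a) * (cos b - 1)| <= 3 * d * H.
  apply: le_trans (ler_normD _ _) _; rewrite !normrM.
  have : `|1 + a| <= 2 by apply: le_trans (ler_normD _ _) _; rewrite normr1;
    lra.
  have s1 : `|expR a - 1 - a| * `|cos b| <= d * H * 1.
    by apply: ler_pM => //; apply: le_trans he _; rewrite ler_wpM2l // ltW.
  move=> h2'; have s2 : `|1 + a| * `|cos b - 1| <= 2 * (d * H).
    by apply: ler_pM => //; apply: le_trans hc _; rewrite ler_wpM2l // ltW.
  lra.
have hIm : `|(expR a - 1) * sin b + (sin b - b)| <= 2 * d * H.
  apply: le_trans (ler_normD _ _) _; rewrite normrM.
  have s1 : `|expR a - 1| <= 2 * H.
    have -> : expR a - 1 = (expR a - 1 - a) + a by ring.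
    have : d * `|a| <= 1 * H by apply: ler_pM => //; apply: ltW.
    move=> h4; apply: le_trans (ler_normD _ _) _; lra.
  have s2 : `|sin b| <= 2 * H.
    have -> : sin b = (sin b - b) + b by ring.
    have : d * `|b| <= 1 * H by apply: ler_pM => //; apply: ltW.
    move=> h4; apply: le_trans (ler_normD _ _) _; lra.
  have s3 : `|expR a - 1| * `|sin b| <= 2 * H * (2 * H) by apply: ler_pM.
  have s4 : `|sin b - b| <= d * H by apply: le_trans hs _;
    rewrite ler_wpM2l // ltW.
  nra.
apply: le_trans (lerD hRe hIm) _; nra.
Qed.

Lemma is_derive_cexp (z : Cfield R) :
  is_derive z 1 (@cexp R : Cfield R -> Cfield R) (cexp z).
Proof.
apply: is_derive_eps => e e0.
have c1 : 0 < Normc.normc (cexp z) + 1 by rewrite ltr_wpDl ?normc_ge0.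
have [t t0 ht] := cexp_derive_eps0 (divr_gt0 e0 c1); exists t => // h /ht hh.
have -> : cexp (h + z) - cexp z - h * cexp z = cexp z * (cexp h - 1 - h).
  by rewrite cexpD; ring.
rewrite Normc.normcM; apply: le_trans (ler_wpM2l (normc_ge0 _) hh) _.
rewrite mulrA; apply: ler_wpM2r; first exact: normc_ge0.
rewrite mulrA ler_pdivrMr // mulrC ler_wpM2l ?ltW // ltrDl.
by [].
Qed.

End ComplexExponential.

Section ComplexLogarithm.
Context (R : realType).

(** The complement of the closed negative real axis, written as positivity of the denominator in the
    half-angle formula for the argument. *)
Definition slit_plane : set R[i] :=
  [set z | 0 < Normc.normc z + complex.Re z].

Lemma slit_disk_plane z : slit_disk z -> slit_plane z.
Proof.
case=> _; rewrite /slit_plane /= => h; rewrite ltNge; apply/negP => le0;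
  apply: h.
have := Re_le_normc z; have := normc_ge0 z; case: z le0 => a b /= le0 n0.
rewrite ler_norml => /andP[na _].
have e : Num.sqrt (a ^+ 2 + b ^+ 2) = - a by apply/eqP; rewrite eq_le;
  apply/andP; split; lra.
split; last by move: n0; rewrite e oppr_ge0.
have : (Num.sqrt (a ^+ 2 + b ^+ 2)) ^+ 2 = (- a) ^+ 2 by rewrite e.
rewrite sqr_sqrtr ?addr_ge0 ?sqr_ge0 // sqrrN => e2.
have /eqP : b ^+ 2 = 0 by lra.
by rewrite sqrf_eq0 => /eqP.
Qed.

(** Equal cosines give [s = t] or [s = - t]. In the second case the sine vanishes, and [s = pi] is
    excluded because then [t] would be [- pi]. *)
Lemma polar_angle_unique (s t : R) : - pi < s <= pi -> - pi < t <= pi ->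
  cos s = cos t -> sin s = sin t -> s = t.
Proof.
move=> /andP[s1 s2] /andP[t1 t2] ec es.
have sin0_eq0 (u : R) : - pi < u < pi -> sin u = 0 -> u = 0.
  move=> /andP[u1 u2] su; have [up|un|//] := ltgtP u 0.
  - have : 0 < sin (- u) by apply: sin_gt0_pi; rewrite oppr_gt0 up /=; lra.
    by rewrite sinN su oppr0 ltxx.
  - have : 0 < sin u by apply: sin_gt0_pi; rewrite un u2.
    by rewrite su ltxx.
have e : `|s| = `|t|.
  apply: cos_inj; rewrite ?cos_norm // in_itv /= normr_ge0 ler_norml;
  apply/andP; split; lra.
case: (eqVneq s t) => // st; have {}e : s = - t.
  by move/eqP: e; rewrite eqr_norm2 (negPf st) /= => /eqP.
have ss : sin s = 0 by move: es; rewrite e sinN => h; lra.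
have s0 : s = 0.
  apply: sin0_eq0 => //; rewrite s1 /=; rewrite lt_neqAle s2 andbT.
  by apply/eqP => sp; move: t1; rewrite -[t]opprK -e sp ltxx.
by rewrite s0; move: e; rewrite s0 => /esym/eqP; rewrite oppr_eq0 => /eqP.
Qed.

Lemma slit_plane_normc_gt0 z : slit_plane z -> 0 < Normc.normc z.
Proof.
rewrite /slit_plane /=; have := Re_le_normc z; rewrite ler_norml => /andP[_].
have := normc_ge0 z; lra.
Qed.

(* Half-angle formula: [tan (arg z / 2) = Im z / (|z| + Re z)]. *)
Lemma cargE z : slit_plane z ->
  carg z = 2 * atan (complex.Im z / (Normc.normc z + complex.Re z)) /\
  z = (Normc.normc z * cos (carg z) +i* (Normc.normc z * sin (carg z)))%C.
Proof.
move=> sz; have n0 := slit_plane_normc_gt0 sz.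
pose p := [set t : R | - pi < t <= pi /\
    z = (Normc.normc z * cos t +i* (Normc.normc z * sin t))%C].
set th := 2 * atan _.
have pth : p th.
  split.
    have := atan_gtNpi2 (complex.Im z / (Normc.normc z + complex.Re z)).
    have := atan_ltpi2 (complex.Im z / (Normc.normc z + complex.Re z)).
    by rewrite -/th /th => h1 h2; apply/andP; split; lra.
  set u := complex.Im z / (Normc.normc z + complex.Re z) in th *.
  have nE : (Normc.normc z) ^+ 2 = complex.Re z ^+ 2 + complex.Im z ^+ 2.
    by case: z {sz n0 p th u} => a b; rewrite /= sqr_sqrtr // addr_ge0 ?sqr_ge0.
  have u1 : 0 < 1 + u ^+ 2 by rewrite ltr_wpDr ?sqr_ge0.
  have c2 : cos (atan u) ^+ 2 = (1 + u ^+ 2)^-1.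
    by rewrite cos_atan exprVn sqr_sqrtr // ltW.
  have cn0 : cos (atan u) != 0.
    by rewrite cos_atan invr_neq0 // sqrtr_eq0 -ltNge.
  have sE : sin (atan u) = u * cos (atan u).
    by rewrite -{2}(atanK u) /tan divfK.
  have cth : cos th = 2 * (1 + u ^+ 2)^-1 - 1.
    by rewrite /th [2 * _]mulr_natl cos_mulr2n c2 mulr2n; ring.
  have sth : sin th = 2 * (u * (1 + u ^+ 2)^-1).
    by rewrite /th [2 * _]mulr_natl sin_mulr2n sE mulrCA -expr2 c2 mulr2n; ring.
  have den : 1 + u ^+ 2 = 2 * Normc.normc z / (Normc.normc z + complex.Re z).
    rewrite /u expr_div_n.
    have -> : complex.Im z ^+ 2 =
      Normc.normc z ^+ 2 - complex.Re z ^+ 2 by rewrite nE addrC addKr.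
    by field; rewrite gt_eqF.
  have s0 : Normc.normc z + complex.Re z != 0 by rewrite gt_eqF.
  have n0' : Normc.normc z != 0 by rewrite gt_eqF.
  rewrite cth sth den; apply/eqP; rewrite eq_complex /=.
  by apply/andP; split; apply/eqP; rewrite ?/u; field; rewrite ?n0' ?s0.
have cE : carg z = th.
  apply: xget_unique => // t [tI zt].
  have [thI zth] := pth; apply: polar_angle_unique => //.
    by have := congr1 (@complex.Re R) zt;
      rewrite {1}zth /= => /(mulfI (lt0r_neq0 n0)).
  by have := congr1 (@complex.Im R) zt;
    rewrite {1}zth /= => /(mulfI (lt0r_neq0 n0)).
by rewrite cE; split=> //; case: pth.
Qed.

Lemma cexp_clog z : slit_plane z -> cexp (clog z) = z.
Proof.
move=> sz; have [_ e] := cargE sz; rewrite /clog /cexp /= lnK;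
  first by rewrite -e.
by rewrite posrE slit_plane_normc_gt0.
Qed.

Lemma near_normc (z : Cfield R) (P : Cfield R -> Prop) :
  (\forall w \near z, P w) -> exists2 t : R, 0 < t & forall h : R[i],
     Normc.normc h < t -> P (h + z).
Proof.
move=> /nbhs_ballP[e /= e0 he].
have eE : e = (complex.Re e)%:C%C by rewrite RRe_real // gtr0_real.
exists (complex.Re e); first by move: e0; rewrite {1}eE ltcR.
move=> h hh; apply: he; rewrite -ball_normE /= opprD addrCA subrr addr0 normrN.
by rewrite eE normC_normc ltcR.
Qed.

Lemma cvg_lipschitz (f : Cfield R -> R) (z : Cfield R) :
  (forall w : R[i], `|f w - f z| <= Normc.normc (w - z : R[i])) ->
  f w @[w --> z] --> f z.
Proof.
move=> hf; have FF : Filter (nbhs z) by exact: nbhs_filter.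
apply/(@cvgrPdist_lt _ _ _ (nbhs z) FF f (f z)) => e e0; apply/nbhs_ballP.
exists e%:C%C; first by rewrite /= ltcR.
move=> w; rewrite -ball_normE /= normC_normc ltcR => hw.
by rewrite distrC; apply: le_lt_trans (hf w) _; rewrite normcB.
Qed.

Lemma cvg_Re (z : Cfield R) : complex.Re (w : R[i]) @[w --> z] --> complex.Re
  (z : R[i]).
Proof. by apply: cvg_lipschitz => w; rewrite -raddfB; apply: Re_le_normc. Qed.

Lemma cvg_Im (z : Cfield R) : complex.Im (w : R[i]) @[w --> z] --> complex.Im
  (z : R[i]).
Proof. by apply: cvg_lipschitz => w; rewrite -raddfB; apply: Im_le_normc. Qed.

Lemma cvg_normc (z : Cfield R) :
  Normc.normc (w : R[i]) @[w --> z] --> Normc.normc (z : R[i]).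
Proof.
apply: cvg_lipschitz => w; rewrite ler_norml.
have h1 := le_normcD (w - z : R[i]) z; have h2 := le_normcD (z - w : R[i]) w.
rewrite !subrK in h1 h2; rewrite normcB in h2.
by apply/andP; split; lra.
Qed.

Lemma near_slit_plane (z : Cfield R) :
  slit_plane z -> \forall w \near z, slit_plane w.
Proof.
move=> sz; have FF : Filter (nbhs z) by exact: nbhs_filter.
have c : Normc.normc (w : R[i]) + complex.Re (w : R[i]) @[w --> z] -->
    Normc.normc (z : R[i]) + complex.Re (z : R[i]).
  by apply: cvgD; [exact: cvg_normc|exact: cvg_Re].
have hn := (@cvgrPdist_lt _ _ _ (nbhs z) FF _ _).1 c _ sz.
apply: (@filterS _ (nbhs z) FF _ _ _ hn) => w;
  rewrite /slit_plane /= ltr_norml => /andP[_]; lra.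
Qed.

Lemma clog_continuous (z : Cfield R) (e : R) : slit_plane z -> 0 < e ->
  \forall w \near z, Normc.normc (clog w - clog z) < e.
Proof.
move=> sz e0; have n0 := slit_plane_normc_gt0 sz.
have e2 : 0 < e / 2 by rewrite divr_gt0.
have FF : Filter (nbhs z) by exact: nbhs_filter.
have cln : ln (Normc.normc (w : R[i])) @[w --> z] --> ln (Normc.normc (z :
  R[i])).
  by apply: (continuous_cvg _ (continuous_ln n0)); apply: cvg_normc.
have carc : 2 * atan (complex.Im (w : R[i]) / (Normc.normc (w : R[i]) +
  complex.Re (w : R[i])))
    @[w --> z] --> 2 * atan (complex.Im (z : R[i]) / (Normc.normc (z : R[i]) +
      complex.Re (z : R[i]))).
  apply: cvgM; first exact: cvg_cst.
  apply: (continuous_cvg _ (@continuous_atan R _)).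
  apply: cvgM; first exact: cvg_Im.
  by apply: cvgV; [rewrite gt_eqF|apply: cvgD;
    [exact: cvg_normc|exact: cvg_Re]].
have n1 := (@cvgrPdist_lt _ _ _ (nbhs z) FF _ _).1 cln _ e2.
have n2 := (@cvgrPdist_lt _ _ _ (nbhs z) FF _ _).1 carc _ e2.
near=> w.
have sw : slit_plane w by near: w; apply: near_slit_plane.
apply: le_lt_trans (normc_le_ReIm _) _.
rewrite /clog !(cargE sw).1 !(cargE sz).1 /=.
have h1 : `|ln (Normc.normc (z : R[i])) - ln (Normc.normc (w : R[i]))| < e / 2
  by near: w.
have h2 : `|2 * atan (complex.Im (z : R[i]) / (Normc.normc (z : R[i]) +
  complex.Re (z : R[i]))) -
   2 * atan (complex.Im (w : R[i]) / (Normc.normc (w : R[i]) + complex.Re (w :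
     R[i])))| < e / 2 by near: w.
rewrite distrC in h1; rewrite distrC in h2; lra.
Unshelve. all: by end_near.
Qed.

(** The logarithm is differentiated as an inverse function. Its increment [k] satisfies
    [cexp k = 1 + h / z], so [k - h / z] is at most [d] times [k]; with [d <= 1/2] this also bounds
    [k] by twice [h / z]. *)
Lemma is_derive_clog (z : Cfield R) : slit_plane z ->
  is_derive z 1 (@clog R : Cfield R -> Cfield R) z^-1.
Proof.
move=> sz; have n0 := slit_plane_normc_gt0 sz.
have zn0 : z != 0 by apply: contraTneq n0 => ->; rewrite Normc.normc0 ltxx.
apply: is_derive_eps => e e0.
pose d := Num.min (e * Normc.normc (z : R[i]) / 2) 2^-1.
have d0 : 0 < d by rewrite lt_min invr_gt0 ltr0n andbT divr_gt0 // mulr_gt0.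
have d1 : d <= 2^-1 by rewrite /d ge_min lexx orbT.
have d2 : d * 2 <= e * Normc.normc (z : R[i]).
  by rewrite -ler_pdivlMr // /d ge_min lexx.
have [t t0 ht] := cexp_derive_eps0 d0.
have [t1 t10 h1] := near_normc (near_slit_plane sz).
have [t2 t20 h2] := near_normc (clog_continuous sz t0).
exists (Num.min t1 t2); first by rewrite lt_min t10.
move=> h; rewrite lt_min => /andP[/h1 sw /h2 hw].
set k := clog (h + z) - clog z in hw *.
have hk := ht k hw.
have ek : cexp k = 1 + h / z.
  have : cexp (clog z) * cexp k = h + z.
    by rewrite -cexpD /k addrC subrK; exact: cexp_clog.
  rewrite cexp_clog // => e1; apply: (mulfI zn0); rewrite e1; field; exact: zn0.
have {hk} hk : Normc.normc (k - h / z) <= d * Normc.normc k.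
  rewrite normcB; move: hk; rewrite ek.
  by have -> : 1 + h / z - 1 - k = h / z - k by ring.
have hk2 : Normc.normc k <= 2 * Normc.normc (h / z).
  have : Normc.normc k <= Normc.normc (k - h / z) + Normc.normc (h / z).
    by apply: le_trans (le_normcD _ _); rewrite subrK.
  have := normc_ge0 k; nra.
apply: le_trans hk _; apply: le_trans (ler_wpM2l (ltW d0) hk2) _.
rewrite Normc.normcM Normc.normcV !mulrA.
have -> : d * 2 * Normc.normc h / Normc.normc (z : R[i]) =
  d * 2 / Normc.normc (z : R[i]) * Normc.normc h by rewrite mulrAC.
by apply: ler_wpM2r; rewrite ?normc_ge0 // ler_pdivrMr.
Qed.

End ComplexLogarithm.

Section ChainRule.
Context (K : numFieldType).

Lemma is_derive_comp (f g : K -> K) (z df dg : K) :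
  is_derive z 1 g dg -> is_derive (g z) 1 f df ->
  is_derive z 1 (f \o g) (dg * df).
Proof.
case=> gd gE [fd fE].
have gdiff := (derivable1_diffP g z).1 gd;
  have fdiff := (derivable1_diffP f (g z)).1 fd.
have cdiff : differentiable (f \o g) z by exact: differentiable_comp.
apply: DeriveDef; first exact/derivable1_diffP.
rewrite -derive1E derive1E' // diff_comp //= -derive1E'// derive1E gE.
rewrite -[dg]mulr1 -[dg * 1]/(dg *: (1 : K^o)) linearZ /= -derive1E' //
  derive1E fE.
by rewrite /GRing.scale /= mulr1.
Qed.

Lemma is_derive_inv (f : K -> K) (z df : K) : f z != 0 ->
  is_derive z 1 f df -> is_derive z 1 (fun w => (f w)^-1) (- df / f z ^+ 2).
Proof.
move=> fn0 [fd <-]; apply: DeriveDef; first exact: derivableV.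
by rewrite deriveV // /GRing.scale /= mulNr mulrC mulNr.
Qed.

End ChainRule.

(** * From formal to analytic solutions *)

Section AnalyticSolutions.
Context (R : realType) (D x : R[i]) (phi G : R[i] -> nat -> R[i]).
Hypothesis phi_rec : forall s j,
  - s * phi (s - 1) j + j.+1%:R * phi (s - 1) j.+1
    - (- (s + 1) * phi s j + j.+1%:R * phi s j.+1)
  = D * phi s j + (x - D) * (phi (s - 1) j - phi s j) - x * (G (s - 1) j - G s
    j).
Hypothesis G_rec : forall s j,
  - s * G (s - 1) j + j.+1%:R * G (s - 1) j.+1
    - (- (s + 1) * G s j + j.+1%:R * G s j.+1)
  = D * G s j + x * phi (s - 1) j - (D + x) * (G (s - 1) j - G s j).
Hypothesis log_bound :
  forall s, exists J, forall j, (J <= j)%N -> phi s j = 0 /\ G s j = 0.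
Hypothesis truncation : forall s, exists N, forall m j, (N <= m)%N ->
  phi (s + m%:R) j = 0 /\ G (s + m%:R) j = 0.

Local Notation a := (level_coef D phi 0).
Local Notation b := (level_coef D phi 1).
Local Notation c := (level_coef D G 0).
Local Notation d := (level_coef D G 1).

Let level2 m : level_coef D phi 2 m = 0 /\ level_coef D G 2 m = 0.
Proof. exact: (log_degree phi_rec G_rec log_bound truncation). Qed.

Lemma a_rec m : theta a m - coef_shift (theta a) m =
  x * a m + (D - x) * coef_shift a m - x * (c m - coef_shift c m)
  - (b m - coef_shift b m).
Proof. by rewrite (level_phi_rec phi_rec G_rec log_bound truncation) mul1r. Qed.

Lemma b_rec m : theta b m - coef_shift (theta b) m =
  x * b m + (D - x) * coef_shift b m - x * (d m - coef_shift d m).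
Proof.
rewrite (level_phi_rec phi_rec G_rec log_bound truncation).
have -> : coef_shift (level_coef D phi 2) m = 0.
  by case: m => //= m; exact: (level2 m).1.
by rewrite (level2 m).1 subrr mulr0 subr0.
Qed.

Lemma c_rec m : theta c m - coef_shift (theta c) m =
  x * a m - x * c m + (D + x) * coef_shift c m - (d m - coef_shift d m).
Proof. by rewrite (level_G_rec phi_rec G_rec log_bound truncation) mul1r. Qed.

Lemma d_rec m : theta d m - coef_shift (theta d) m =
  x * b m - x * d m + (D + x) * coef_shift d m.
Proof.
rewrite (level_G_rec phi_rec G_rec log_bound truncation).
have -> : coef_shift (level_coef D G 2) m = 0.
  by case: m => //= m; exact: (level2 m).2.
by rewrite (level2 m).2 subrr mulr0 subr0.
Qed.

Let norm := @Normc.normc R.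

(** Six terms suffice for each of the four recurrences; the shorter ones are padded with zero
    coefficients. *)
Lemma norm_linear_combination (K : R) (p1 p2 p3 p4 p5 p6 u1 u2 u3 u4 u5 u6 :
  R[i]) :
  [/\ norm p1 <= K, norm p2 <= K, norm p3 <= K & [/\ norm p4 <=
    K, norm p5 <= K & norm p6 <= K]] ->
  norm (p1 * u1 + p2 * u2 + p3 * u3 + p4 * u4 + p5 * u5 + p6 * u6) <=
  K * (norm u1 + norm u2 + norm u3 + norm u4 + norm u5 + norm u6).
Proof.
case=> h1 h2 h3 [h4 h5 h6]; rewrite !mulrDr.
have one p u : norm p <= K -> norm (p * u) <= K * norm u.
  by move=> h; rewrite /norm Normc.normcM ler_wpM2r ?normc_ge0.
do 5 (apply: le_trans (le_normcD _ _) _; apply: lerD; last exact: one).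
exact: one.
Qed.

Lemma theta_step (u : nat -> R[i]) m rest :
  theta u m.+1 - coef_shift (theta u) m.+1 = rest ->
  m.+1%:R * norm (u m.+1) <= m%:R * norm (u m) + norm rest.
Proof.
rewrite /theta /= => e.
have -> : m.+1%:R * norm (u m.+1) = norm (m.+1%:R * u m.+1).
  by rewrite /norm Normc.normcM normc_nat.
have -> : m%:R * norm (u m) = norm (m%:R * u m).
  by rewrite /norm Normc.normcM normc_nat.
by rewrite addrC; apply: le_trans (le_normcD _ _); rewrite -e subrK.
Qed.

(** The four sequences are coupled, so growth is estimated for the sum [S] of their norms. *)
Lemma level_subexponential :
  [/\ subexponential a, subexponential b, subexponential c & subexponential d].
Proof.
pose S m := norm (a m) + norm (b m) + norm (c m) + norm (d m).
(* [K] dominates every coefficient of the recurrences: 0, 1, [x], [D - x], [D + x] and the negatives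
   that occur. Adding the four estimates gives the constant [4 * K]. *)
pose K := norm x + norm D + 1.
have n0 z : 0 <= norm z by exact: normc_ge0.
have nx : norm x <= K by rewrite /K; have := n0 D; lra.
have nNx : norm (- x) <= K by rewrite /norm normcN.
have n1 : norm 1 <= K by rewrite /norm Normc.normc1 /K; have := n0 D;
  have := n0 x; lra.
have nN1 : norm (- 1) <= K by rewrite /norm normcN.
have nz : norm 0 <= K by rewrite /norm Normc.normc0 /K; have := n0 D;
  have := n0 x; lra.
have nDx : norm (D - x) <= K.
  by rewrite /norm; apply: le_trans (le_normcD _ _) _;
    rewrite normcN /K /norm; lra.
have nDx' : norm (D + x) <= K.
  by rewrite /norm; apply: le_trans (le_normcD _ _) _; rewrite /K /norm; lra.
have growth r : 0 < r < 1 -> exists C, forall m, S m * r ^+ m <= C.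
  apply: (@linear_recurrence_growth R S (4 * K)).
  - by move=> m; rewrite /S !addr_ge0.
  - by rewrite mulr_ge0 // (le_trans (n0 x) nx).
  move=> m.
  have ea := theta_step (a_rec m.+1); have eb := theta_step (b_rec m.+1).
  have ec := theta_step (c_rec m.+1); have ed := theta_step (d_rec m.+1).
  rewrite /= in ea eb ec ed.
  have ra : norm (x * a m.+1 + (D - x) * a m - x * (c m.+1 - c m) - (b m.+1 - b
    m))
     <= K * (S m.+1 + S m).
    have -> : x * a m.+1 + (D - x) * a m - x * (c m.+1 - c m) - (b m.+1 - b m) =
      x * a m.+1 + (D - x) * a m + - x * c m.+1 + x * c m + - 1 * b m.+1 + 1 *
        b m by ring.
    apply: le_trans (norm_linear_combination _ _ _ _ _ _ (And4 nx nDx nNx (And3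
      nx nN1 n1))) _.
    apply: ler_wpM2l; first exact: le_trans (n0 x) nx.
    rewrite /S; have := n0 (d m); have := n0 (d m.+1); lra.
  have rb : norm (x * b m.+1 + (D - x) * b m - x * (d m.+1 - d m)) <=
    K * (S m.+1 + S m).
    have -> : x * b m.+1 + (D - x) * b m - x * (d m.+1 - d m) =
      x * b m.+1 + (D - x) * b m + - x * d m.+1 + x * d m + 0 * a m.+1 + 0 * a
        m by ring.
    apply: le_trans (norm_linear_combination _ _ _ _ _ _ (And4 nx nDx nNx (And3
      nx nz nz))) _.
    apply: ler_wpM2l; first exact: le_trans (n0 x) nx.
    rewrite /S; have := n0 (c m); have := n0 (c m.+1); lra.
  have rc : norm (x * a m.+1 - x * c m.+1 + (D + x) * c m - (d m.+1 - d m)) <=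
    K * (S m.+1 + S m).
    have -> : x * a m.+1 - x * c m.+1 + (D + x) * c m - (d m.+1 - d m) =
      x * a m.+1 + 0 * a m + - x * c m.+1 + (D + x) * c m + - 1 * d m.+1 + 1 *
        d m by ring.
    apply: le_trans (norm_linear_combination _ _ _ _ _ _ (And4 nx nz nNx (And3
      nDx' nN1 n1))) _.
    apply: ler_wpM2l; first exact: le_trans (n0 x) nx.
    rewrite /S; have := n0 (b m); have := n0 (b m.+1); lra.
  have rd : norm (x * b m.+1 - x * d m.+1 + (D + x) * d m) <=
    K * (S m.+1 + S m).
    have -> : x * b m.+1 - x * d m.+1 + (D + x) * d m =
      x * b m.+1 + 0 * b m + - x * d m.+1 + (D + x) * d m + 0 * a m.+1 + 0 * a
        m by ring.
    apply: le_trans (norm_linear_combination _ _ _ _ _ _ (And4 nx nz nNx (And3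
      nDx' nz nz))) _.
    apply: ler_wpM2l; first exact: le_trans (n0 x) nx.
    rewrite /S; have := n0 (c m); have := n0 (c m.+1); lra.
  have {ra} {}ea := le_trans ea (lerD (lexx _) ra).
  have {rb} {}eb := le_trans eb (lerD (lexx _) rb).
  have {rc} {}ec := le_trans ec (lerD (lexx _) rc).
  have {rd} {}ed := le_trans ed (lerD (lexx _) rd).
  rewrite -mulrA; move: (K * _) ea eb ec ed => X ea eb ec ed.
  by rewrite /S !mulrDr; lra.
have sub (u : nat -> R[i]) : (forall m, norm (u m) <= S m) -> subexponential u.
  move=> hu r rr; have [C hC] := growth r rr; exists C => m.
  apply: le_trans (hC m); apply: ler_wpM2r; last exact: hu.
  by rewrite exprn_ge0 //; case/andP: rr => /ltW.
split; apply: sub => m; rewrite /S; have := n0 (a m); have := n0 (b m);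
  have := n0 (c m); have := n0 (d m); lra.
Qed.

Section System.
Context (z : R[i]).
Hypothesis z1 : Normc.normc z < 1.

Local Notation P u := (power_series u z).

Lemma power_series_one_minus u : subexponential u ->
  has_csum (fun m => (u m - coef_shift u m) * z ^+ m) ((1 - z) * P u).
Proof.
move=> hu; rewrite mulrBl mul1r.
apply: has_csum_eq (has_csumB (power_series_sum hu z1) (power_series_shift hu
  z1)) => m.
by rewrite mulrBl.
Qed.

Lemma power_series_system :
  [/\ (1 - z) * P (theta a) =
        x * P a + (D - x) * (z * P a) - x * ((1 - z) * P c) - (1 - z) * P b,
      (1 - z) * P (theta b) =
        x * P b + (D - x) * (z * P b) - x * ((1 - z) * P d),
      (1 - z) * P (theta c) =
        x * P a - x * P c + (D + x) * (z * P c) - (1 - z) * P d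
    & (1 - z) * P (theta d) = x * P b - x * P d + (D + x) * (z * P d)].
Proof.
have [ha hb hc hd] := level_subexponential.
have sub u := power_series_one_minus (subexponential_theta u).
have Pa := power_series_sum ha z1; have Pb := power_series_sum hb z1.
have Pc := power_series_sum hc z1; have Pd := power_series_sum hd z1.
have Sa := power_series_shift ha z1; have Sb := power_series_shift hb z1.
have Sc := power_series_shift hc z1; have Sd := power_series_shift hd z1.
have Ob := power_series_one_minus hb; have Oc := power_series_one_minus hc.
have Od := power_series_one_minus hd.
split.
- apply: has_csum_unique (sub _ ha) _.
  apply: has_csum_eq (has_csumB (has_csumB (has_csumD (has_csumZ x Pa)
    (has_csumZ (D - x) Sa)) (has_csumZ x Oc)) Ob) => m.
  by rewrite a_rec; ring.
- apply: has_csum_unique (sub _ hb) _.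
  apply: has_csum_eq (has_csumB (has_csumD (has_csumZ x Pb)
    (has_csumZ (D - x) Sb)) (has_csumZ x Od)) => m.
  by rewrite b_rec; ring.
- apply: has_csum_unique (sub _ hc) _.
  apply: has_csum_eq (has_csumB (has_csumD (has_csumB (has_csumZ x Pa)
    (has_csumZ x Pc)) (has_csumZ (D + x) Sc)) Od) => m.
  by rewrite c_rec; ring.
- apply: has_csum_unique (sub _ hd) _.
  apply: has_csum_eq (has_csumD (has_csumB (has_csumZ x Pb)
    (has_csumZ x Pd)) (has_csumZ (D + x) Sd)) => m.
  by rewrite d_rec; ring.
Qed.

End System.

Definition log_solution (u v : nat -> R[i]) : Cfield R -> Cfield R := fun z =>
  cexp (- D * clog z) * (power_series u z + clog z * power_series v z).

Lemma is_derive_log_solution u v (z : Cfield R) :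
  subexponential u -> subexponential v -> slit_disk z ->
  is_derive z 1 (log_solution u v)
    (z^-1 * (- D * log_solution u v z + cexp (- D * clog z) *
      (power_series (theta u) z + clog z * power_series (theta v) z +
        power_series v z))).
Proof.
move=> hu hv sz; have sp := slit_disk_plane sz.
have z1 : Normc.normc (z : R[i]) < 1 by case: sz; rewrite normC_normc ltcR.
have zn0 : z != 0.
  by apply: contraTneq (slit_plane_normc_gt0 sp) => ->;
    rewrite Normc.normc0 ltxx.
have dl := is_derive_clog sp.
have du := is_derive_power_series hu zn0 z1;
  have dv := is_derive_power_series hv zn0 z1.
have dc : is_derive z 1 ((- D : Cfield R) \*: (@clog R : Cfield R ->
  Cfield R)) (- D *: z^-1).
  exact: is_deriveZ.
have de := is_derive_comp dc (is_derive_cexp _).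
have dm := is_deriveM dl dv.
have := is_deriveM de (is_deriveD du dm).
move=> h; apply: is_derive_eq h _.
have -> : (power_series u + (@clog R : Cfield R ->
  Cfield R) * power_series v) z =
  power_series u z + clog z * power_series v z by [].
rewrite /log_solution /= /GRing.scale /=; field.
exact: zn0.
Qed.

Lemma slit_disk_facts (z : Cfield R) : slit_disk z ->
  [/\ Normc.normc (z : R[i]) < 1, z != 0 & 1 - z != 0].
Proof.
move=> sz; have z1 : Normc.normc (z : R[i]) < 1 by case: sz;
  rewrite normC_normc ltcR.
split=> //.
  apply: contraTneq (slit_plane_normc_gt0 (slit_disk_plane sz)) => ->.
  by rewrite Normc.normc0 ltxx.
by apply: contraTneq z1 => /subr0_eq <-; rewrite Normc.normc1 ltxx.
Qed.

Lemma near_slit_disk (z : Cfield R) : slit_disk z ->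
  \forall w \near z, slit_disk w.
Proof.
move=> sz; have [z1 _ _] := slit_disk_facts sz.
have FF : Filter (nbhs z) by exact: nbhs_filter.
have d0 : 0 < 1 - Normc.normc (z : R[i]) by rewrite subr_gt0.
have n1 := (@cvgrPdist_lt _ _ _ (nbhs z) FF _ _).1 (@cvg_normc R z) _ d0.
have n2 := near_slit_plane (slit_disk_plane sz).
near=> w; split.
  rewrite normC_normc ltcR.
  have : `|Normc.normc (z : R[i]) - Normc.normc (w : R[i])| < 1 - Normc.normc
    (z : R[i]) by near: w.
  by rewrite ltr_norml => /andP[h _]; lra.
have sw : slit_plane w by near: w.
case=> i0 r0; move: sw; rewrite /slit_plane /=.
have := normc_le_ReIm (w : R[i]); rewrite i0 normr0 addr0 ler0_norm //; lra.
Unshelve. all: by end_near.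
Qed.

Lemma log_solution_system (z : Cfield R) : slit_disk z ->
  is_derive z 1 (log_solution a b)
    (((x - D + (2 * D - x) * z) / (z * (1 - z))) * log_solution a b z
     - x / z * log_solution c d z) /\
  is_derive z 1 (log_solution c d)
    (x / (z * (1 - z)) * log_solution a b z
     + ((- D - x + (2 * D + x) * z) / (z * (1 - z))) * log_solution c d z).
Proof.
move=> sz; have [ha hb hc hd] := level_subexponential.
have [z1 z0 z10] := slit_disk_facts sz.
have [e1 e2 e3 e4] := power_series_system z1.
have red (p q : R[i]) : (1 - z) * p = q -> p = q / (1 - z).
  by move=> <-; rewrite mulrC mulKf.
split.
  apply: is_derive_eq (is_derive_log_solution ha hb sz) _.
  rewrite (red _ _ e1) (red _ _ e2) /log_solution.
  by field; rewrite z0 z10.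
apply: is_derive_eq (is_derive_log_solution hc hd sz) _.
rewrite (red _ _ e3) (red _ _ e4) /log_solution.
by field; rewrite z0 z10.
Qed.

End AnalyticSolutions.

(** * The second-order equation and its application to the correlation function *)

(** The factor after [z * (1 - z)] is the derivative of [df] with [A'] written out. After
    substitution of the system, the coefficients of [f] and of [g] vanish separately. *)
Lemma hypergeometric_identity (K : fieldType) (z x D f g : K) :
  z != 0 -> 1 - z != 0 ->
  let A := (x - D + (2 * D - x) * z) / (z * (1 - z)) in
  let df := A * f - x / z * g in
  let dg := x / (z * (1 - z)) * f + (- D - x + (2 * D + x) * z) / (z * (1 - z))
    * g in
  z * (1 - z) *
    (((2 * D - x) / (z * (1 - z))
      - (x - D + (2 * D - x) * z) * (1 - 2 * z) / (z * (1 - z)) ^+ 2) * f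
     + A * df + x / z ^+ 2 * g - x / z * dg)
  + ((2 * D + 1) - (4 * D + 1) * z) * df
  + D ^+ 2 * z^-1 * f + D * (D - 1) * (1 - z)^-1 * f
  + (x ^+ 2 - 4 * D ^+ 2) * f = 0.
Proof.
move=> z0 z1 A df dg; rewrite /dg /df /A; field.
by rewrite z0 z1. Qed.

Section HypergeometricEquation.
Context (R : realType) (D x c2 : R[i]).

Lemma is_derive_fraction (p q : R[i]) (z : Cfield R) : z != 0 -> 1 - z != 0 ->
  is_derive z 1 ((fun w => (p + q * w) / (w * (1 - w))) : Cfield R -> Cfield R)
    (q / (z * (1 - z)) - (p + q * z) * (1 - 2 * z) / (z * (1 - z)) ^+ 2).
Proof.
move=> z0 z10.
have num : is_derive z 1 ((fun w => p + q * w) : Cfield R -> Cfield R) q.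
  apply: (@is_derive_quadratic _ _ _ _ 1 0) => // h _.
  have -> : p + q * (h + z) - (p + q * z) - h * q = 0 by ring.
  by rewrite Normc.normc0 mulr0.
have den : is_derive z 1 ((fun w => w * (1 - w)) : Cfield R ->
  Cfield R) (1 - 2 * z).
  apply: (@is_derive_quadratic _ _ _ _ 1 1) => // h _.
  have -> : (h + z) * (1 - (h + z)) - z * (1 - z) - h * (1 - 2 * z) =
    - h ^+ 2 by ring.
  by rewrite normcN normcX mulr1.
have dn0 : z * (1 - z) != 0 by rewrite mulf_neq0.
have h := is_deriveM num (@is_derive_inv _ (fun w => w * (1 - w)) _ _ dn0 den).
have {}h : is_derive z 1 ((fun w => (p + q * w) / (w * (1 - w))) : Cfield R ->
  Cfield R) _ := h.
by apply: is_derive_eq h _; rewrite /GRing.scale /=; field; rewrite z0 z10.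
Qed.

Lemma first_order_system_ode (Phi Gam F : Cfield R -> Cfield R) :
  (forall z : Cfield R, slit_disk z ->
    is_derive z 1 Phi
      (((x - D + (2 * D - x) * z) / (z * (1 - z))) * Phi z - x / z * Gam z) /\
    is_derive z 1 Gam
      (x / (z * (1 - z)) * Phi z
       + ((- D - x + (2 * D + x) * z) / (z * (1 - z))) * Gam z)) ->
  (forall w, slit_disk w -> F w = c2 * Phi w) ->
  forall z : Cfield R, slit_disk z ->
  [/\ derivable F z 1, derivable (derive1 F) z 1
    & z * (1 - z) * derive1n 2 F z
      + ((2 * D + 1) - (4 * D + 1) * z) * derive1 F z
      + D ^+ 2 * z^-1 * F z
      + D * (D - 1) * (1 - z)^-1 * F z
      + (x ^+ 2 - 4 * D ^+ 2) * F z = 0].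
Proof.
move=> system FE.
pose H (w : Cfield R) : Cfield R :=
  c2 * (((x - D + (2 * D - x) * w) / (w * (1 - w))) * Phi w
     - x / w * Gam w).
have dF (w : Cfield R) : slit_disk w -> is_derive w 1 F (H w).
  move=> sw; have [d1 _] := system w sw.
  have dz := is_deriveZ (c2 : Cfield R) d1.
  (* [F] is only known on the slit disk; as this set is open, the agreement with [c2 * Phi] holds in
     a neighbourhood and passes to derivatives. *)
  apply: (near_eq_is_derive _ dz).
  by apply: filterS (near_slit_disk sw) => y sy; rewrite FE.
move=> z sz; have [z1 z0 z10] := slit_disk_facts sz.
have [d1 d2] := system z sz.
have F1 (w : Cfield R) : slit_disk w -> derive1 F w = H w.
  by move=> sw; rewrite derive1E; have [_ ->] := dF w sw.
pose dH : R[i] := c2 * (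
  ((2 * D - x) / (z * (1 - z)) - (x - D + (2 * D - x) * z) * (1 - 2 * z) / (z *
    (1 - z)) ^+ 2)
    * Phi z
  + ((x - D + (2 * D - x) * z) / (z * (1 - z))) *
    (((x - D + (2 * D - x) * z) / (z * (1 - z))) * Phi z
     - x / z * Gam z)
  + x / z ^+ 2 * Gam z
  - x / z * (x / (z * (1 - z)) * Phi z
     + ((- D - x + (2 * D + x) * z) / (z * (1 - z))) * Gam z)).
have dHz : is_derive z 1 H dH.
  have dA1 := is_derive_fraction (x - D) (2 * D - x) z0 z10.
  have dA2 : is_derive z 1 ((fun w => x / w) : Cfield R ->
    Cfield R) (- x / z ^+ 2).
    have dV := @is_derive_inv _ id _ _ z0 (is_derive_id z (1 : Cfield R)).
    apply: is_derive_eq (is_deriveZ (x : Cfield R) dV) _.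
    by rewrite /GRing.scale /= mulrA mulrN1.
  have h := is_deriveZ (c2 : Cfield R) (is_deriveB (is_deriveM dA1 d1)
    (is_deriveM dA2 d2)).
  have {}h : is_derive z 1 H _ := h.
  by apply: is_derive_eq h _; rewrite /dH /GRing.scale /=; field;
    rewrite z0 z10.
have dF2 : is_derive z 1 (derive1 F) dH.
  apply: (near_eq_is_derive _ dHz).
  by apply: filterS (near_slit_disk sz) => y sy; rewrite F1.
have [fd _] := dF z sz; have [fd2 fE2] := dF2.
split; [exact: fd|exact: fd2|].
rewrite derive1nS derive1n1 derive1E fE2 (F1 z sz) (FE z sz) /H /dH.
have /= id := hypergeometric_identity x D (Phi z) (Gam z) z0 z10.
rewrite -[RHS](mulr0 (c2 : Cfield R)) -[X in _ = _ * X]id.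
ring.
Qed.

End HypergeometricEquation.

(** At [s = D - 1 - m] the factor [cexp (- (s + 1) * clog z)] splits as
    [cexp (- D * clog z) * z ^+ m]. The two surviving powers of the logarithm give the two power
    series. *)
Lemma log_solution_csum (R : realType) (D c2 : R[i]) (f : R[i] -> nat -> R[i])
    (term : R[i] -> R[i]) (z : R[i]) :
  let a := level_coef D f 0 in let b := level_coef D f 1 in
  slit_disk z -> subexponential a -> subexponential b ->
  (forall s, exists2 J, (2 <= J)%N &
     term s = c2 * \sum_(j < J) cexp (- (s + 1) * clog z) * clog z ^+ j * f s
       j) ->
  (forall s, (forall m : nat, s != D - 1 - m%:R) -> forall j, f s j = 0) ->
  (forall m j, (2 <= j)%N -> f (D - 1 - m%:R) j = 0) ->
  has_csum term (c2 * log_solution D a b z).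
Proof.
move=> a b sz ha hb termE supp deg.
have [z1 _ _] := slit_disk_facts sz; have sp := slit_disk_plane sz.
apply: (has_csum_inj (h := fun m : nat => D - 1 - m%:R)).
- by move=> m m' /(congr1 (fun y => D - 1 - y)); rewrite !subKr => /eqP;
  rewrite eqr_nat => /eqP.
- move=> s hs; have [J _ ->] := termE s; rewrite big1 ?mulr0 // => j _.
  by rewrite supp // mulr0.
have := has_csumZ (c2 * cexp (- D * clog z))
  (has_csumD (power_series_sum ha z1) (has_csumZ (clog z) (power_series_sum hb
    z1))).
rewrite -mulrA -/(log_solution D a b z).
apply: has_csum_eq => m; have [[//|[//|J]] _ ->] := termE (D - 1 - m%:R).
rewrite 2!big_ord_recl big1 => [|j _]; last by rewrite deg // mulr0.
have -> : - (D - 1 - m%:R + 1) * clog z = - D * clog z + m%:R * clog z by ring.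
rewrite cexpD cexpX cexp_clog // /a /b /level_coef /=; ring.
Qed.

Theorem theorem4p1p4 (R : realType) (k n e : R[i]) (Vk : Vk_gl11 k)
    (V X W : vmodule Vk) (v : V) (v' : X)
    (B : parity_reversal X -> V -> R[i])
    (Y1 : V -> R[i] -> nat -> W -> V)
    (Y2 : parity_reversal X -> R[i] -> nat -> V -> W)
    (v0 : parity_reversal X) :
  k != 0 ->
  (forall m : int, e / k != m%:~R) ->
  is_Vhat n e v ->
  is_Vhat (- n) (- e) v' ->
  contragredient_pairing B ->
  even_intertwining_operator Y1 ->
  even_intertwining_operator Y2 ->
  lowest_conformal_weight_vector v0 ->
  let Delta : R[i] := e / k * (n + e / (2 * k)) in
  let term (z : R[i]) : R[i] -> R[i] :=
    product_term B Y1 Y2 v0 v 0 v' (clog z) (affine_mode gPsim 0 v) in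
  let phi : Cfield R -> Cfield R := fun z => csum (term z) in
  forall z : Cfield R, slit_disk z ->
  [/\ has_csum (term z) (phi z),
      derivable phi z 1,
      derivable (derive1 phi) z 1
    & z * (1 - z) * derive1n 2 phi z
      + ((4 * Delta + 1) - (8 * Delta + 1) * z) * derive1 phi z
      + 4 * Delta ^+ 2 * z^-1 * phi z
      + 2 * Delta * (2 * Delta - 1) * (1 - z)^-1 * phi z
      + ((e / k) ^+ 2 - 16 * Delta ^+ 2) * phi z = 0].
Proof.
move=> k0 _ [iV HV ->] [iX HX ->] HB HY1 HY2 lv0 Delta term phi.
(* Parity reversal changes neither modes nor weights, so [lv0] applies to [X] itself by
   conversion. *)
have [_ [[c1 c2] v0E]] := lowest_weight_vector_top k0 HX lv0.
pose D := 2 * Delta.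
pose f := phi_coef iV iX B Y1 Y2; pose g := G_coef iV iX B Y1 Y2.
have f_rec := phi_recurrence k0 HV HX HB HY1 HY2.
have g_rec := G_recurrence k0 HV HX HB HY1 HY2.
have bound := coef_log_bound k0 HV HX HB HY1 HY2.
have log_bound s : exists J, forall j, (J <= j)%N -> f s j = 0 /\ g s j = 0.
  by have [J hJ] := bound s; exists J => j /hJ[].
have trunc := coef_truncation k0 HV HX HB HY1 HY2.
have [ha hb _ _] := level_subexponential f_rec g_rec log_bound trunc.
have sumE z : slit_disk z ->
    has_csum (term z) (c2 * log_solution D (level_coef D f 0) (level_coef D f
      1) z).
  move=> sz; apply: log_solution_csum => //.
  (* The bound is raised to at least 2 so that the terms [j = 0] and [j = 1] can always be split
     off. *)
  - move=> s; have [J hJ] := bound s; exists (maxn J 2); first exact: leq_maxr.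
    rewrite /term v0E (_ : affine_mode gPsim 0 _ = iV (0, 1)); last first.
      exact: (top_zero_mode HV).
    apply: (product_termE k0 HV HX HB HY1 HY2) => j.
    by rewrite geq_max => /andP[/hJ[-> _ _] _].
  - by move=> s hs j; have [] :=
    exponent_support f_rec g_rec log_bound trunc hs j.
  - by move=> m j j2; have [] := log_degree f_rec g_rec log_bound trunc m j2.
have phiE z : slit_disk z ->
    phi z = c2 * log_solution D (level_coef D f 0) (level_coef D f 1) z.
  by move=> sz; apply: csumE; apply: sumE.
move=> z sz; have system := log_solution_system f_rec g_rec log_bound trunc.
have [d1 d2 ode] := first_order_system_ode system phiE sz.
split=> //; first exact: has_csum_csum (sumE z sz).
by rewrite -[RHS]ode /Delta; ring.
Qed.
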